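(* Let $m\ge 2$ and $1\le n\le m$ be integers. Let $\rho$ be a density operator on $\mathcal{H}_A\otimes\mathcal{H}_{B_1}\otimes\cdots\otimes\mathcal{H}_{B_n}$ (finite-dimensional, $\dim\mathcal{H}_A=d$). Let $M_1,\dots,M_m$ be observables on $\mathcal{H}_A$ with orthonormal eigenbases $\{|\psi^i_k\rangle\}_{k=1}^d$. Let $\mathbf{S}_1,\dots,\mathbf{S}_n$ be nonempty, pairwise disjoint subsets of $\{M_1,\dots,M_m\}$ whose union is $\{M_1,\dots,M_m\}$, and $m_t=|\mathbf{S}_t|$. Let $U$ be a real number such that $\sum_{i=1}^m H(M_i)\geqslant U$. Then $$\sum_{t=1}^n\sum_{M_i\in\mathbf{S}_t}S(M_i|B_t)\geqslant U_{SCB}+\max\Big\{0,\;U-U_{SCB}-\sum_{t=1}^n\sum_{M_i\in\mathbf{S}_t}\mathcal{I}(M_i:B_t)\Big\},$$ where $$U_{SCB}=-\frac{1}{m-1}\log_2\Big(\prod_{1\le i<j\le m}c_{ij}\Big)+\frac{1}{m-1}\sum_{t=1}^n\frac{m_t(m_t-1)}{2}S(A|B_t).$$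
   Context: All logarithms are base 2. $S(\sigma)=-\mathrm{Tr}\,\sigma\log_2\sigma$; $\rho^X$ is the reduced state of $\rho$ on subsystem(s) $X$. $H(M_i)=-\sum_k p^i_k\log_2p^i_k$ with $p^i_k=\langle\psi^i_k|\rho^A|\psi^i_k\rangle$ (Shannon entropy of the outcome distribution of $M_i$). $c_{ij}=\max_{k,l}|\langle\psi^i_k|\psi^j_l\rangle|^2$. $S(A|B_t)=S(\rho^{AB_t})-S(\rho^{B_t})$. Post-measurement state: $\rho^{M_iB_t}=\sum_k(|\psi^i_k\rangle\langle\psi^i_k|\otimes\mathbb{I})\rho^{AB_t}(|\psi^i_k\rangle\langle\psi^i_k|\otimes\mathbb{I})$, with reduced state $\rho^{M_i}$ on $A$. $S(M_i|B_t)=S(\rho^{M_iB_t})-S(\rho^{B_t})$, and $\mathcal{I}(M_i:B_t)=S(\rho^{M_i})+S(\rho^{B_t})-S(\rho^{M_iB_t})$. *)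

(* Defs.v *)
From HB Require Import structures.
From mathcomp Require Import all_boot all_order all_algebra.
From mathcomp Require Import complex.
From mathcomp Require Import reals exp.

Set Implicit Arguments.
Unset Strict Implicit.
Unset Printing Implicit Defensive.

Import Order.TTheory GRing.Theory Num.Theory.
Local Open Scope ring_scope.

Section QDefs.
Variable R : realType.
Local Notation C := R[i].

Definition log2 (x : R) : R := ln x / ln 2.
Definition xlog2x (x : R) : R := if x == 0 then 0 else x * log2 x.
Definition op (T : finType) := T -> T -> C.
Definition mx_of (T : finType) (f : op T) : 'M[C]_#|T| :=
  \matrix_(i, j) f (enum_val i) (enum_val j).
Definition vN_entropy (T : finType) (f : op T) : R :=
  - \sum_(i < #|T|) xlog2x (complex.Re (spectral_diag (mx_of f) 0 i)).

Definition vec (T : finType) := T -> C.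

Definition herm_op (T : finType) (f : op T) : Prop :=
  forall x y, f y x = (f x y)^*.
Definition psd_op (T : finType) (f : op T) : Prop :=
  herm_op f /\
  forall v : vec T, 0 <= \sum_x \sum_y (v x)^* * f x y * v y.
Definition tr_op (T : finType) (f : op T) : C := \sum_x f x x.
Definition density_op (T : finType) (f : op T) : Prop := psd_op f /\ tr_op f = 1.

Definition qinner (T : finType) (u v : vec T) : C := \sum_x (u x)^* * v x.

Definition orthonormal_basis (d : nat) (psi : 'I_d -> vec 'I_d) : Prop :=
  forall k l, qinner (psi k) (psi l) = (k == l)%:R.
Definition is_eigvec (d : nat) (M : op 'I_d) (v : vec 'I_d) : Prop :=
  exists lam : C, forall a, \sum_b M a b * v b = lam * v a.

(* the composite index set of H_A (x) H_B1 (x) ... (x) H_Bn *)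
Definition TI (d n : nat) (db : 'I_n -> nat) : finType :=
  ('I_d * {dffun forall t : 'I_n, 'I_(db t)})%type.

Definition rho_A (d n : nat) (db : 'I_n -> nat) (rho : op (TI d db)) : op 'I_d :=
  fun a a' => \sum_(x : TI d db) \sum_(y : TI d db |
      [&& x.1 == a, y.1 == a' & x.2 == y.2]) rho x y.
Definition rho_ABt (d n : nat) (db : 'I_n -> nat) (rho : op (TI d db)) (t : 'I_n)
  : op ('I_d * 'I_(db t))%type :=
  fun p q => \sum_(x : TI d db) \sum_(y : TI d db |
      [&& x.1 == p.1, y.1 == q.1, x.2 t == p.2, y.2 t == q.2 &
          [forall s : 'I_n, (s != t) ==> (x.2 s == y.2 s)]]) rho x y.
Definition rho_Bt (d n : nat) (db : 'I_n -> nat) (rho : op (TI d db)) (t : 'I_n)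
  : op 'I_(db t) :=
  fun b b' => \sum_(x : TI d db) \sum_(y : TI d db |
      [&& x.2 t == b, y.2 t == b', x.1 == y.1 &
          [forall s : 'I_n, (s != t) ==> (x.2 s == y.2 s)]]) rho x y.

Arguments rho_ABt {d n db} rho t.
Arguments rho_Bt {d n db} rho t.

Definition ketbra (d : nat) (v : vec 'I_d) : op 'I_d := fun a a' => v a * (v a')^*.

(* post-measurement state sum_k (P_k (x) I) f (P_k (x) I), P_k = |psi_k><psi_k| *)
Definition post_meas (d : nat) (T : finType) (psi : 'I_d -> vec 'I_d)
  (f : op ('I_d * T)%type) : op ('I_d * T)%type :=
  fun p q => \sum_(k < d) \sum_(a1 < d) \sum_(a2 < d)
     ketbra (psi k) p.1 a1 * f (a1, p.2) (a2, q.2) * ketbra (psi k) a2 q.1.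

Definition trace_2 (d : nat) (T : finType) (f : op ('I_d * T)%type) : op 'I_d :=
  fun a a' => \sum_(b : T) f (a, b) (a', b).

Definition prob (d : nat) (rA : op 'I_d) (psi : 'I_d -> vec 'I_d) (k : 'I_d) : R :=
  complex.Re (\sum_a \sum_a' (psi k a)^* * rA a a' * psi k a').
Definition shannonH (d : nat) (rA : op 'I_d) (psi : 'I_d -> vec 'I_d) : R :=
  - \sum_(k < d) xlog2x (prob rA psi k).

Definition sqnorm (z : C) : R := (complex.Re z) ^+ 2 + (complex.Im z) ^+ 2.

Definition cmax (d : nat) (psi1 psi2 : 'I_d -> vec 'I_d) : R :=
  \big[Num.max/0]_(k < d) \big[Num.max/0]_(l < d) sqnorm (qinner (psi1 k) (psi2 l)).

Definition condS_ABt (d n : nat) (db : 'I_n -> nat) (rho : op (TI d db)) (t : 'I_n) : R :=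
  vN_entropy (rho_ABt rho t) - vN_entropy (rho_Bt rho t).
Definition condS_MBt (d n : nat) (db : 'I_n -> nat) (rho : op (TI d db))
  (psi : 'I_d -> vec 'I_d) (t : 'I_n) : R :=
  vN_entropy (post_meas psi (rho_ABt rho t)) - vN_entropy (rho_Bt rho t).
Definition mutinf_MBt (d n : nat) (db : 'I_n -> nat) (rho : op (TI d db))
  (psi : 'I_d -> vec 'I_d) (t : 'I_n) : R :=
  vN_entropy (trace_2 (post_meas psi (rho_ABt rho t))) + vN_entropy (rho_Bt rho t)
  - vN_entropy (post_meas psi (rho_ABt rho t)).

Definition U_SCB (m d n : nat) (db : 'I_n -> nat) (rho : op (TI d db))
  (psi : 'I_m -> 'I_d -> vec 'I_d) (S : 'I_n -> {set 'I_m}) : R :=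
  - (m.-1%:R)^-1 * log2 (\prod_(i < m) \prod_(j < m | (i < j)%N) cmax (psi i) (psi j))
  + (m.-1%:R)^-1 * \sum_(t < n) ((#|S t| * (#|S t|).-1)%:R / 2) * condS_ABt rho t.

End QDefs.

(* Main.v *)
Require Import Defs.
From HB Require Import structures.
From mathcomp Require Import all_boot all_order all_algebra.
From mathcomp Require Import complex.
From mathcomp Require Import boolp reals exp.
From mathcomp Require Import ring lra.
Import Order.TTheory GRing.Theory Num.Theory.
Local Open Scope ring_scope.
Set Implicit Arguments.
Unset Strict Implicit.
Unset Printing Implicit Defensive.

(** Fix two of the measurements, [X] and [Z]. If both are assigned to the memory
    [B], data processing for the relative entropy [D] gives
    [D(rho_AB || P_Z rho_AB) >= D(P_X rho_AB || P_X P_Z rho_AB)], and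
    [P_X P_Z rho_AB <= c_XZ (1 (x) rho_B)] turns this into
    [S(Z|B) - S(A|B) >= - log c_XZ - S(X|B)]. If [Z] is assigned to another memory
    [B'], purify the state: [S(ZB) - S(AB)] equals [S(Z|W)] for the complement [W]
    of [AB], which contains [B'], so it is at most [S(Z|B')] by data processing
    for the partial trace. Adding these bounds over all pairs gives [U_SCB]; the
    other term of the maximum is [S(M|B) + I(M:B) = H(M)].

    Data processing is proved without integrals or operator monotone functions.
    A telescoping Riemann sum for the logarithm writes [D] as a limit of
    nonnegative combinations of
    [F_s = sum_ij |<e_i|g_j>|^2 p_i^2 / ((1 - s) p_i + s q_j)], and
    [F_s = sup_K 2 Re Tr(rho K) - s Tr(sigma K K^* ) - (1 - s) Tr(rho K^* K)]
    is a supremum of functions affine in [(rho, sigma)]. *)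

(** * The logarithm as a limit of Riemann sums *)

Section LogRiemann.
Variable R : realType.
Implicit Types (s : R) (N : nat).

Lemma lnB_le (x y : R) : 0 < x -> 0 < y -> ln x - ln y <= (x - y) / y.
Proof.
move=> x0 y0; rewrite -ln_div ?posrE//.
have -> : x / y = 1 + (x - y) / y by field; rewrite gt_eqF.
by apply: le_ln1Dx; rewrite mulrBl divff ?gt_eqF// ltrBDl subrr divr_gt0.
Qed.

Definition mix (s p q : R) : R := (1 - s) * p + s * q.

Lemma mix_gt0 s (p q : R) : 0 <= s <= 1 -> 0 < p -> 0 < q -> 0 < mix s p q.
Proof.
move=> /andP[s0 s1] p0 q0; rewrite /mix.
have [->|s_neq0] := eqVneq s 0; first by rewrite subr0 mul1r mul0r addr0.
rewrite ltr_wpDl//; first by rewrite mulr_ge0 ?subr_ge0// ltW.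
by rewrite mulr_gt0// lt_neqAle eq_sym s_neq0.
Qed.

(** Right-endpoint Riemann sum, with [N] steps, of the integral of [p (p - q) / mix s p q] over
    [0 <= s <= 1], which is [p (ln p - ln q)]. Since [p - mix s p q = s (p - q)], each term is a
    resolvent minus [p], with a positive coefficient. *)
Definition lnsum N (p q : R) : R :=
  \sum_(0 <= k < N) k.+1%:R^-1 * (p ^+ 2 / mix (k.+1%:R / N%:R) p q - p).

(** The integrand is nondecreasing in [s], so the right-endpoint sum overestimates the integral, by
    at most the step [1 / N] times the total increase. Termwise, both bounds are [lnB_le] at
    consecutive nodes. *)
Lemma lnsum_bounds N (p q : R) : (0 < N)%N -> 0 < p -> 0 < q ->
  p * (ln p - ln q) <= lnsum N p q
    <= p * (ln p - ln q) + N%:R^-1 * (p * ((q - p) ^+ 2 / (p * q))).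
Proof.
move=> N0 p0 q0; have Np : 0 < N%:R :> R by rewrite ltr0n.
have Nn : N%:R != 0 :> R by rewrite gt_eqF.
pose m k := mix (k%:R / N%:R) p q.
have m0 k : (k <= N)%N -> 0 < m k.
  move=> kN; apply: mix_gt0 => //; rewrite divr_ge0 ?ler0n//=.
  by rewrite ler_pdivrMr// mul1r ler_nat.
have mS k : m k.+1 - m k = (q - p) / N%:R.
  by rewrite /m /mix -(natr1 k); field.
have mm0 : m 0%N = p by rewrite /m /mix mul0r subr0 mul1r mul0r addr0.
have mmN : m N = q by rewrite /m /mix divff// subrr mul0r add0r mul1r.
have tel : ln q - ln p = \sum_(0 <= k < N) (ln (m k.+1) - ln (m k)).
  by rewrite telescope_sumr// mm0 mmN.
have telV : p^-1 - q^-1 = \sum_(0 <= k < N) ((m k)^-1 - (m k.+1)^-1).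
  rewrite -[LHS]opprB -mmN -mm0 -(telescope_sumr (fun k => (m k)^-1))//.
  by rewrite -sumrN; apply: eq_bigr => k _; rewrite opprB.
have lnsumE : lnsum N p q = \sum_(0 <= k < N) (p * ((p - q) / N%:R / m k.+1)).
  rewrite /lnsum !big_nat; apply: eq_bigr => k /andP[_ kN].
  have := m0 _ kN; rewrite /m /mix => mk0; move: (gt_eqF mk0) => mk.
  have k0 : k.+1%:R != 0 :> R by rewrite pnatr_eq0.
  set c : R := k.+1%:R in mk0 mk k0 *; set n : R := N%:R in Nn mk0 mk *.
  have E : (1 - c / n) * p + c / n * q = ((n - c) * p + c * q) / n by field.
  rewrite E in mk0 mk *; have X0 : (n - c) * p + c * q != 0.
    by apply: contraFneq mk => ->; rewrite mul0r.
  by clearbody c n; field; rewrite Nn k0 X0.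
apply/andP; split.
  rewrite lnsumE -[ln p - _]opprB tel mulrN -mulrN -sumrN mulr_sumr !big_nat.
  apply: ler_sum => k /andP[_ kN]; rewrite ler_pM2l// opprB.
  apply: le_trans (lnB_le (m0 _ (ltnW kN)) (m0 _ kN)) _.
  by rewrite -[m k - _]opprB mS -mulNr opprB.
rewrite lnsumE -[ln p - _]opprB tel mulrN -mulrN.
have -> : N%:R^-1 * (p * ((q - p) ^+ 2 / (p * q))) =
   \sum_(0 <= k < N) p * ((q - p) / N%:R * ((m k)^-1 - (m k.+1)^-1)).
  rewrite -mulr_sumr -mulr_sumr -telV; field.
  by rewrite Nn !gt_eqF.
rewrite -sumrN mulr_sumr -big_split/= !big_nat; apply: ler_sum => k /andP[_ kN].
rewrite -mulrDr ler_pM2l// mulrBr -[p - q]opprB !mulNr.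
have := lnB_le (m0 _ kN) (m0 _ (ltnW kN)); rewrite mS.
lra.
Qed.

(* The resolvents [p^2 / ((1 - s) p + s q)] determine [p (ln p - ln q)] as a
   limit of nonnegative combinations, up to a multiple of [p]. *)
Lemma rel_le_of_resolvents (X Y : finType) (w p q : X -> R) (w' p' q' : Y -> R) :
  (forall x, 0 <= w x) -> (forall x, 0 <= p x) -> (forall x, 0 <= q x) ->
  (forall x, q x = 0 -> w x * p x = 0) ->
  (forall x, 0 <= w' x) -> (forall x, 0 <= p' x) -> (forall x, 0 <= q' x) ->
  (forall x, q' x = 0 -> w' x * p' x = 0) ->
  \sum_x w x * p x = \sum_y w' y * p' y ->
  (forall s, 0 < s <= 1 ->
     \sum_y w' y * (p' y ^+ 2 / mix s (p' y) (q' y)) <=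
     \sum_x w x * (p x ^+ 2 / mix s (p x) (q x))) ->
  \sum_y w' y * (p' y * (ln (p' y) - ln (q' y))) <=
  \sum_x w x * (p x * (ln (p x) - ln (q x))).
Proof.
have bounds (Z : finType) (v a b : Z -> R) N : (0 < N)%N ->
    (forall x, 0 <= v x) -> (forall x, 0 <= a x) -> (forall x, 0 <= b x) ->
    (forall x, b x = 0 -> v x * a x = 0) -> forall x,
    v x * (a x * (ln (a x) - ln (b x))) <= v x * lnsum N (a x) (b x)
    <= v x * (a x * (ln (a x) - ln (b x)))
       + N%:R^-1 * (v x * (a x * ((b x - a x) ^+ 2 / (a x * b x)))).
  move=> N0 v0 a0 b0 sup x.
  (* Without mass every term is zero; otherwise the support condition makes [v x], [a x] and [b x]
     positive and [lnsum_bounds] applies. *)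
  have [va0|va0] := eqVneq (v x * a x) 0.
    have -> : v x * lnsum N (a x) (b x) = 0.
      move/eqP: va0; rewrite mulf_eq0 => /orP[/eqP->|/eqP->]; rewrite ?mul0r//.
      rewrite /lnsum big1 ?mulr0// => k _.
      by rewrite expr0n/= mul0r subrr mulr0.
    have z e : v x * (a x * e) = 0 by rewrite mulrA va0 mul0r.
    by rewrite !z mulr0 addr0 lexx.
  have [ax vx] : a x != 0 /\ v x != 0.
    by move: va0; rewrite mulf_eq0 negb_or => /andP[].
  have bx : b x != 0 by apply: contra_neq va0 => /sup.
  have pos y : 0 <= y -> y != 0 -> 0 < y :> R.
    by move=> ? ?; rewrite lt_neqAle eq_sym; apply/andP.
  have /andP[h1 h2] :=
    lnsum_bounds N0 (pos _ (a0 x) ax) (pos _ (b0 x) bx).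
  have vx0 := pos _ (v0 x) vx.
  by rewrite ler_pM2l// h1/= [N%:R^-1 * _]mulrCA -mulrDr ler_pM2l.
move=> w0 p0 q0 sup w0' p0' q0' sup' mass res.
set L := (X in X <= _); set D := (X in _ <= X).
pose B := \sum_x w x * (p x * ((q x - p x) ^+ 2 / (p x * q x))).
have le_N N : (0 < N)%N -> L <= D + N%:R^-1 * B.
  move=> N0.
  apply: (@le_trans _ _ (\sum_y w' y * lnsum N (p' y) (q' y))).
    by apply: ler_sum => y _; have /andP[] := bounds _ _ _ _ _ N0 w0' p0' q0' sup' y.
  apply: (@le_trans _ _ (\sum_x w x * lnsum N (p x) (q x))); last first.
    rewrite /D /B mulr_sumr -big_split/=; apply: ler_sum => x _.
    by have /andP[] := bounds _ _ _ _ _ N0 w0 p0 q0 sup x.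
  have expand (Z : finType) (v a b : Z -> R) :
      \sum_x v x * lnsum N (a x) (b x) = \sum_(0 <= k < N) k.+1%:R^-1 *
        (\sum_x v x * (a x ^+ 2 / mix (k.+1%:R / N%:R) (a x) (b x))
         - \sum_x v x * a x).
    under eq_bigr do rewrite mulr_sumr; rewrite exchange_big/=.
    apply: eq_bigr => k _; rewrite -sumrB mulr_sumr; apply: eq_bigr => x _.
    by rewrite -mulrBr mulrCA.
  (* Equal total masses cancel the [- p] parts, so only resolvents at the nodes [s = k.+1 / N],
     which are positive, are compared. *)
  rewrite !expand mass !big_nat; apply: ler_sum => k /andP[_ kN].
  rewrite ler_pM2l ?invr_gt0 ?ltr0n// lerD2r; apply: res.
  by rewrite divr_gt0 ?ltr0n//= ler_pdivrMr ?ltr0n// mul1r ler_nat.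
have B0 : 0 <= B.
  apply: sumr_ge0 => x _; do 2 apply: mulr_ge0 => //.
  by apply: divr_ge0; [exact: sqr_ge0|exact: mulr_ge0].
apply/ler_addgt0Pr => e e0.
(* Large enough for the error [B / N] to stay below [e]. *)
pose N := (Num.truncn (B / e)).+1.
apply: le_trans (le_N N isT) _; rewrite lerD2l mulrC ler_pdivrMr ?ltr0n//.
rewrite mulrC -ler_pdivrMr// ltW//.
exact: truncnS_gt.
Qed.

End LogRiemann.

Local Notation Re := (@complex.Re _).
Local Notation ktr := (@tr_op _ _).
Local Notation "x %:C" := (real_complex _ x).

(** * Real parts and squared moduli *)

Section ComplexParts.
Variable R : realType.
Local Notation C := R[i].
Implicit Types (x y z : C) (r : R).

Lemma Re_add x y : Re (x + y) = Re x + Re y.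
Proof. by case: x; case: y. Qed.

Lemma Re_sum (I : finType) (F : I -> C) : Re (\sum_i F i) = \sum_i Re (F i).
Proof. exact: (big_morph Re Re_add). Qed.

Lemma Re_mulC r z : Re (r%:C * z) = r * Re z.
Proof. by case: z => a b /=; rewrite mul0r subr0. Qed.

Lemma conjC_real r : (r%:C)^* = r%:C.
Proof. exact: conjc_real. Qed.

Lemma mul_conjC_sqnorm z : z * z^* = (sqnorm z)%:C.
Proof. by rewrite -normCK -add_Re2_Im2. Qed.

Lemma sqnorm_conj z : sqnorm z^* = sqnorm z.
Proof. by case: z => a b; rewrite /sqnorm/= sqrrN. Qed.

Lemma sqnorm_ge0 z : 0 <= sqnorm z.
Proof. by rewrite addr_ge0// sqr_ge0. Qed.

Lemma sqnorm0 : sqnorm (0 : C) = 0.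
Proof. by rewrite /sqnorm/= expr0n addr0. Qed.

Lemma sqnorm1 : sqnorm (1 : C) = 1.
Proof. by rewrite /sqnorm/= expr1n expr0n addr0. Qed.

Lemma sqnorm_eq0 z : sqnorm z = 0 -> z = 0.
Proof.
case: z => a b /eqP; rewrite /sqnorm/= paddr_eq0 ?sqr_ge0//.
by rewrite !sqrf_eq0 => /andP[/eqP-> /eqP->].
Qed.

Lemma sqnormM x y : sqnorm (x * y) = sqnorm x * sqnorm y.
Proof. by case: x => a b; case: y => c e; rewrite /sqnorm/=; ring. Qed.

Lemma sqnorm_real r : sqnorm r%:C = r ^+ 2.
Proof. by rewrite /sqnorm/= expr0n addr0. Qed.

End ComplexParts.

(** * Operators as kernels on finite types *)

Section KernelDefs.
Variable R : realType.
Local Notation C := R[i].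

(** Kernels between arbitrary finite types stand for rectangular matrices, so that composite systems
    are indexed by products without enumeration. *)
Definition kmul (T U V : finType) (f : T -> U -> C) (g : U -> V -> C) : T -> V -> C :=
  fun x z => \sum_y f x y * g y z.
Definition kadj (T U : finType) (f : T -> U -> C) : U -> T -> C :=
  fun x y => (f y x)^*.
Definition kone (T : finType) : T -> T -> C := fun x y => (x == y)%:R.
Definition kdiag (T : finType) (p : T -> R) : T -> T -> C :=
  fun x y => (p x)%:C * (x == y)%:R.
(** With [f] read as the amplitude of a pure state on [T] and [U], this is the reduced state on [T].
    Every positive operator has this form by [psd_op_kgram]. *)
Definition kgram (T U : finType) (f : T -> U -> C) : op R T := kmul f (kadj f).

End KernelDefs.

Local Notation "f ** g" := (kmul f g) (at level 40, left associativity).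
Local Notation "f ^a" := (kadj f) (at level 2, format "f ^a").

Section Kernels.
Variable R : realType.
Local Notation C := R[i].

Lemma kmulA (T U V W : finType) (f : T -> U -> C) (g : U -> V -> C) (h : V -> W -> C) :
  f ** (g ** h) = f ** g ** h.
Proof.
apply: funext => x; apply: funext => z; rewrite /kmul.
under eq_bigr do rewrite mulr_sumr; rewrite exchange_big/=.
by apply: eq_bigr => v _; rewrite mulr_suml; apply: eq_bigr => u _; rewrite mulrA.
Qed.

Lemma kmul1 (T U : finType) (f : T -> U -> C) : f ** @kone R U = f.
Proof.
apply: funext => x; apply: funext => z; rewrite /kmul (bigD1 z)//= /kone eqxx mulr1.
by rewrite big1 ?addr0// => y /negPf->; rewrite mulr0.
Qed.

Lemma kmul1l (T U : finType) (f : T -> U -> C) : @kone R T ** f = f.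
Proof.
apply: funext => x; apply: funext => z; rewrite /kmul (bigD1 x)//= /kone eqxx mul1r.
by rewrite big1 ?addr0// => y; rewrite eq_sym => /negPf->; rewrite mul0r.
Qed.

Lemma kmul_diag (T U : finType) (p : T -> R) (f : T -> U -> C) x z :
  (kdiag p ** f) x z = (p x)%:C * f x z.
Proof.
rewrite /kmul (bigD1 x)//= /kdiag eqxx mulr1 big1 ?addr0// => y.
by rewrite eq_sym => /negPf->; rewrite mulr0 mul0r.
Qed.

Lemma kmul_diagr (T U : finType) (p : U -> R) (f : T -> U -> C) x z :
  (f ** kdiag p) x z = f x z * (p z)%:C.
Proof.
rewrite /kmul (bigD1 z)//= /kdiag eqxx mulr1 big1 ?addr0// => y.
by move=> /negPf->; rewrite !mulr0.
Qed.

Lemma kadjK (T U : finType) (f : T -> U -> C) : f^a^a = f.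
Proof. by apply: funext => x; apply: funext => y; rewrite /kadj conjCK. Qed.

Lemma kadjM (T U V : finType) (f : T -> U -> C) (g : U -> V -> C) :
  (f ** g)^a = g^a ** f^a.
Proof.
apply: funext => x; apply: funext => y; rewrite /kadj /kmul rmorph_sum.
by apply: eq_bigr => z _; rewrite rmorphM mulrC.
Qed.

Lemma ktrC (T U : finType) (f : T -> U -> C) (g : U -> T -> C) :
  ktr (f ** g) = ktr (g ** f).
Proof.
rewrite /tr_op /kmul exchange_big/=; apply: eq_bigr => y _.
by apply: eq_bigr => x _; rewrite mulrC.
Qed.

Lemma ktr_diag (T : finType) (p : T -> R) (f : op R T) :
  ktr (kdiag p ** f) = \sum_x (p x)%:C * f x x.
Proof. by apply: eq_bigr => x _; rewrite kmul_diag. Qed.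

Lemma kgramE (T U : finType) (f : T -> U -> C) x : kgram f x x = (\sum_y sqnorm (f x y))%:C.
Proof.
by rewrite /kgram /kmul rmorph_sum; apply: eq_bigr => y _; rewrite mul_conjC_sqnorm.
Qed.

(** Both identities are stated because [T] and [I] are different types. *)
Definition unitary (T I : finType) (E : T -> I -> C) :=
  E^a ** E = @kone R I /\ E ** E^a = @kone R T.

(** The eigenvalue index [I] is free, so that a direct sum of blocks can use a product index. *)
Definition spectral_dec (T I : finType) (f : op R T) (E : T -> I -> C) (p : I -> R) :=
  [/\ unitary E, forall i, 0 <= p i & f = E ** kdiag p ** E^a].

Lemma unitary_adj (T I : finType) (E : T -> I -> C) : unitary E -> unitary E^a.
Proof. by case=> h1 h2; split; rewrite kadjK. Qed.

Lemma unitary_mul (T I J : finType) (E : T -> I -> C) (G : I -> J -> C) :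
  unitary E -> unitary G -> unitary (E ** G).
Proof.
case=> h1 h2 [g1 g2]; split; rewrite kadjM.
  by rewrite -kmulA (kmulA _ E) h1 kmul1l.
by rewrite kmulA -(kmulA E) g2 kmul1.
Qed.

Lemma unitary_row (T I : finType) (E : T -> I -> C) : unitary E ->
  forall x, \sum_i sqnorm (E x i) = 1.
Proof.
case=> _ h x.
by apply: (@complexI R); rewrite -kgramE /kgram h /kone eqxx rmorph1.
Qed.

Lemma unitary_col (T I : finType) (E : T -> I -> C) : unitary E ->
  forall i, \sum_x sqnorm (E x i) = 1.
Proof.
move=> /unitary_adj/unitary_row h i; rewrite -(h i).
by apply: eq_bigr => x _; rewrite /kadj sqnorm_conj.
Qed.

(** * The variational formula for resolvent sums *)

Section Variational.
Variables (T I J : finType) (f g : op R T).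
Variables (E : T -> I -> C) (p : I -> R) (G : T -> J -> C) (q : J -> R).
Hypotheses (specf : spectral_dec f E p) (specg : spectral_dec g G q).

Definition variational (s : R) (h k : op R T) (K : T -> T -> C) : R :=
  2 * Re (ktr (h ** K)) - s * Re (ktr (k ** (K ** K^a)))
  - (1 - s) * Re (ktr (h ** (K^a ** K))).

Definition overlap (i : I) (j : J) : R := sqnorm ((E^a ** G) i j).

Lemma overlap_unitary : unitary (E^a ** G).
Proof.
have [uE _ _] := specf; have [uG _ _] := specg.
by apply: unitary_mul uG; apply: unitary_adj.
Qed.

Lemma diag_overlap j : (G^a ** f ** G) j j = (\sum_i p i * overlap i j)%:C.
Proof.
have [_ _ ->] := specf.
have -> : G^a ** (E ** kdiag p ** E^a) ** G = (G^a ** E) ** (kdiag p ** (E^a ** G)).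
  by rewrite !kmulA.
rewrite {1}/kmul rmorph_sum; apply: eq_bigr => i _.
rewrite kmul_diag mulrCA rmorphM/=; congr (_ * _).
rewrite mulrC -mul_conjC_sqnorm; congr (_ * _).
by rewrite -[G^a ** E]kadjK kadjM kadjK.
Qed.

(** In the eigenbases of [f] and [g] the functional decouples into one scalar quadratic in [k j i]
    for each pair [i], [j]. *)
Lemma variational_expand s (k : J -> I -> C) :
  variational s f g (G ** k ** E^a) =
  \sum_i \sum_j (2 * (p i * Re ((E^a ** G) i j * k j i))
                 - mix s (p i) (q j) * sqnorm (k j i)).
Proof.
have [[E1 E2] _ fE] := specf; have [[G1 G2] _ gE] := specg.
have Ka : (G ** k ** E^a)^a = E ** k^a ** G^a by rewrite !kadjM kadjK kmulA.
have t1 : Re (ktr (f ** (G ** k ** E^a))) =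
    \sum_i \sum_j p i * Re ((E^a ** G) i j * k j i).
  have -> : f ** (G ** k ** E^a) = E ** (kdiag p ** ((E^a ** G) ** k) ** E^a).
    by rewrite fE !kmulA.
  rewrite ktrC -kmulA E1 kmul1 ktr_diag Re_sum; apply: eq_bigr => i _.
  by rewrite Re_mulC {1}/kmul Re_sum mulr_sumr.
have t2 : Re (ktr (g ** (G ** k ** E^a ** (G ** k ** E^a)^a))) =
    \sum_i \sum_j q j * sqnorm (k j i).
  have -> : g ** (G ** k ** E^a ** (G ** k ** E^a)^a) =
     G ** (kdiag q ** ((G^a ** G) ** (k ** (E^a ** E) ** k^a)) ** G^a).
    by rewrite Ka gE !kmulA.
  rewrite ktrC -kmulA G1 E1 kmul1 kmul1 kmul1l ktr_diag Re_sum exchange_big/=.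
  apply: eq_bigr => j _.
  by rewrite Re_mulC -/(kgram k) kgramE/= mulr_sumr.
have t3 : Re (ktr (f ** ((G ** k ** E^a)^a ** (G ** k ** E^a)))) =
    \sum_i \sum_j p i * sqnorm (k j i).
  have -> : f ** ((G ** k ** E^a)^a ** (G ** k ** E^a)) =
     E ** (kdiag p ** ((E^a ** E) ** (k^a ** (G^a ** G) ** k)) ** E^a).
    by rewrite Ka fE !kmulA.
  rewrite ktrC -kmulA G1 E1 kmul1 kmul1 kmul1l ktr_diag Re_sum.
  apply: eq_bigr => i _; rewrite Re_mulC.
  rewrite -[X in _ ** X](kadjK k) -/(kgram k^a) kgramE/= mulr_sumr.
  by apply: eq_bigr => j _; rewrite /kadj sqnorm_conj.
rewrite /variational t1 t2 t3 !mulr_sumr -!sumrB; apply: eq_bigr => i _.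
rewrite !mulr_sumr -!sumrB; apply: eq_bigr => j _.
by rewrite /mix; ring.
Qed.

Hypothesis supp : forall i j, q j = 0 -> overlap i j * p i = 0.

Lemma variational_le s K : 0 < s <= 1 ->
  variational s f g K <= \sum_i \sum_j overlap i j * (p i ^+ 2 / mix s (p i) (q j)).
Proof.
move=> /andP[s0 s1].
have [[E1 E2] p0 fE] := specf; have [[G1 G2] q0 gE] := specg.
have -> : K = G ** (G^a ** K ** E) ** E^a.
  by rewrite !kmulA G2 kmul1l -kmulA E2 kmul1.
rewrite variational_expand; apply: ler_sum => i _; apply: ler_sum => j _.
have a0 : 0 <= (1 - s) * p i by rewrite mulr_ge0// subr_ge0.
have b0 : 0 <= s * q j by rewrite mulr_ge0// ltW.
have m0 : 0 <= mix s (p i) (q j) by rewrite addr_ge0.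
have [mE|mN] := eqVneq (mix s (p i) (q j)) 0.
  rewrite mE invr0 !mulr0 mul0r subr0.
  (* As [s > 0], a vanishing [mix] forces [q j = 0]; the support condition then removes the linear
     term, in agreement with the convention that the inverse of zero is zero. *)
  have qj : q j = 0.
    move/eqP: mE; rewrite paddr_eq0// => /andP[_].
    by rewrite mulf_eq0 (gt_eqF s0) => /eqP.
  have /eqP := supp i qj; rewrite mulf_eq0 => /orP[/eqP/sqnorm_eq0 ->|/eqP->].
    by rewrite mul0r/= !mulr0.
  by rewrite mul0r mulr0.
have {mN}m0 : 0 < mix s (p i) (q j) by rewrite lt_neqAle eq_sym mN.
move: (mix s _ _) m0 => m m0; rewrite /overlap.
case: ((E^a ** G) i j) => x y; case: ((G^a ** K ** E) j i) => u v.
rewrite /sqnorm/= [X in _ <= X]mulrA ler_pdivlMr// -subr_ge0.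
(* Completing the square. *)
have -> : (x ^+ 2 + y ^+ 2) * p i ^+ 2 -
   (2 * (p i * (x * u - y * v)) - m * (u ^+ 2 + v ^+ 2)) * m =
   (m * u - p i * x) ^+ 2 + (m * v + p i * y) ^+ 2 by ring.
by rewrite addr_ge0 ?sqr_ge0.
Qed.

Lemma variational_attained s : exists K,
  variational s f g K = \sum_i \sum_j overlap i j * (p i ^+ 2 / mix s (p i) (q j)).
Proof.
(* The maximiser of each scalar quadratic; where [mix] vanishes this entry is zero. *)
exists (G ** (fun j i => (p i / mix s (p i) (q j))%:C * ((E^a ** G) i j)^*) ** E^a).
rewrite variational_expand; apply: eq_bigr => i _; apply: eq_bigr => j _.
rewrite [(E^a ** G) i j * _]mulrCA Re_mulC mul_conjC_sqnorm/= sqnormM sqnorm_conj sqnorm_real.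
rewrite -/(overlap i j).
have [->|mN] := eqVneq (mix s (p i) (q j)) 0.
  by rewrite invr0 !(mulr0, mul0r) subr0.
by field.
Qed.

End Variational.
End Kernels.

(** * Spectral decompositions and von Neumann entropy *)

Section Entropy.
Variable R : realType.
Local Notation C := R[i].

Lemma ln2_gt0 : 0 < ln 2 :> R.
Proof. by rewrite ln_gt0// ltr1n. Qed.

Lemma xlog2xE (x : R) : xlog2x x = x * ln x / ln 2.
Proof.
by rewrite /xlog2x /log2; case: eqP => [->|_]; rewrite ?mul0r// mulrA.
Qed.

Lemma psd_kgram (T U : finType) (M : T -> U -> C) : psd_op (kgram M).
Proof.
split=> [x y|v].
  have h : (kgram M)^a = kgram M by rewrite /kgram kadjM kadjK.
  by rewrite -{1}h.
have -> : \sum_x \sum_y (v x)^* * kgram M x y * v y =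
    kgram (fun (_ : unit) u => \sum_x (v x)^* * M x u) tt tt.
  rewrite {2}/kgram /kmul /kadj.
  under [RHS]eq_bigr do rewrite rmorph_sum mulr_suml.
  rewrite [RHS]exchange_big/=; apply: eq_bigr => x _.
  under [RHS]eq_bigr do rewrite mulr_sumr.
  rewrite [RHS]exchange_big/=; apply: eq_bigr => y _.
  rewrite /kgram /kmul /kadj mulr_sumr mulr_suml; apply: eq_bigr => u _.
  rewrite rmorphM/= conjCK; ring.
by rewrite kgramE ler0c sumr_ge0// => u _; rewrite sqnorm_ge0.
Qed.

(** The spectral theorem for hermitian matrices, carried over to kernels through [enum_rank]. *)
Lemma spectral_dec_exists (T : finType) (f : op R T) : psd_op f ->
  exists (E : T -> 'I_#|T| -> C) (p : 'I_#|T| -> R),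
    spectral_dec f E p /\ vN_entropy f = - \sum_i xlog2x (p i).
Proof.
case=> hf pf; set A := mx_of f; set P := spectralmx A; set D := spectral_diag A.
have hA : A \is hermsymmx.
  apply/is_hermitianmxP; rewrite expr0 scale1r; apply/matrixP => i j.
  by rewrite !mxE; exact: hf.
have nA := hermitian_normalmx hA.
have uP : P \is unitarymx by exact: spectral_unitarymx.
have AE : A = (P ^t Num.conj)%sesqui *m diag_mx D *m P.
  by rewrite -(invmx_unitary uP); apply/orthomx_spectralP.
have PP1 : P *m (P ^t Num.conj)%sesqui = 1%:M by apply/unitarymxP.
have PP2 : (P ^t Num.conj)%sesqui *m P = 1%:M by apply: mulmx1C.
pose E (x : T) (i : 'I_#|T|) : C := (P i (enum_rank x))^*.
pose p i := Re (D 0 i).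
have uE : unitary E.
  split; apply: funext => i; apply: funext => j; rewrite /kmul /kadj /E.
    have := congr1 (fun M : 'M[C]__ => M i j) PP1; rewrite !mxE => h.
    rewrite /kone -h (reindex (@enum_rank T)) /=; last first.
      by apply: onW_bij; apply: enum_rank_bij.
    by apply: eq_bigr => x _; rewrite conjCK !mxE.
  have := congr1 (fun M : 'M[C]__ => M (enum_rank i) (enum_rank j)) PP2.
  rewrite !mxE (inj_eq enum_rank_inj) => h.
  by rewrite /kone -h; apply: eq_bigr => x _; rewrite conjCK !mxE.
have fE : f = E ** (fun i j => D 0 i * (i == j)%:R) ** E^a.
  apply: funext => x; apply: funext => y.
  have := congr1 (fun M : 'M[C]__ => M (enum_rank x) (enum_rank y)) AE.
  rewrite mxE !enum_rankK => ->; rewrite !mxE /kmul.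
  apply: eq_bigr => j _; rewrite /kadj /E conjCK; congr (_ * _).
  rewrite mul_mx_diag !mxE (bigD1 j)//= eqxx mulr1 big1 ?addr0// => i /negPf->.
  by rewrite !mulr0.
(* Each eigenvalue is the quadratic form at its eigenvector, hence real and nonnegative. *)
have DE i : D 0 i = \sum_x \sum_y (E x i)^* * f x y * E y i.
  have : (E^a ** f ** E) i i = D 0 i.
    have [E1 _] := uE.
    by rewrite fE !kmulA E1 kmul1l -kmulA E1 kmul1 eqxx mulr1.
  move=> <-; rewrite /kmul exchange_big/=; apply: eq_bigr => y _.
  by rewrite mulr_suml.
have D0 i : 0 <= D 0 i by rewrite DE pf.
have DR i : D 0 i = (p i)%:C by rewrite /p RRe_real// ger0_real.
exists E, p; split => //; split => // [i|].
  by rewrite -ler0c -DR.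
rewrite [LHS]fE; congr (_ ** _ ** _); apply: funext => i; apply: funext => j.
by rewrite DR.
Qed.

(** A nonzero entry of [E^a ** G] forces [p i = q j], and the squared moduli of the entries have
    unit row and column sums. Averaging [h] with these weights compares the two sums without
    matching multiplicities. *)
Lemma spectral_dec_unique (T I J : finType) (f : op R T) (h : R -> R)
    (E : T -> I -> C) (p : I -> R) (G : T -> J -> C) (q : J -> R) :
  spectral_dec f E p -> spectral_dec f G q -> \sum_i h (p i) = \sum_j h (q j).
Proof.
move=> sE sG; have uO := overlap_unitary sE sG.
have [[E1 E2] _ fE] := sE; have [[G1 G2] _ fG] := sG.
have eig i j : (p i)%:C * (E^a ** G) i j = (E^a ** G) i j * (q j)%:C.
  have : E^a ** f ** G = kdiag p ** (E^a ** G).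
    by rewrite fE !kmulA E1 kmul1l.
  have -> : E^a ** f ** G = (E^a ** G) ** kdiag q.
    by rewrite fG !kmulA -kmulA G1 kmul1.
  move=> /(congr1 (fun M => M i j)).
  by rewrite kmul_diagr kmul_diag => ->.
transitivity (\sum_i \sum_j sqnorm ((E^a ** G) i j) * h (p i)).
  by apply: eq_bigr => i _; rewrite -mulr_suml unitary_row// mul1r.
rewrite exchange_big/=; apply: eq_bigr => j _.
transitivity (\sum_i sqnorm ((E^a ** G) i j) * h (q j)).
  apply: eq_bigr => i _; have [->|aN] := eqVneq ((E^a ** G) i j) 0.
    by rewrite sqnorm0 !mul0r.
  have := eig i j; rewrite mulrC => /(mulfI aN)/complexI ->.
  by [].
by rewrite -mulr_suml unitary_col// mul1r.
Qed.

Lemma spectral_dec_kgram (T I : finType) (f : op R T) (E : T -> I -> C) (p : I -> R) :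
  spectral_dec f E p -> f = kgram (E ** kdiag (fun i => Num.sqrt (p i))).
Proof.
move=> [_ p0 fE]; rewrite /kgram kadjM kmulA -(kmulA E) fE; congr (_ ** _ ** _).
apply: funext => i; apply: funext => j; rewrite kmul_diag /kadj /kdiag.
rewrite rmorphM/= conjC_real rmorph_nat eq_sym; have [->|] := eqVneq.
  by rewrite !mulr1 -rmorphM/= -expr2 sqr_sqrtr.
by rewrite !mulr0.
Qed.

Lemma psd_op_kgram (T : finType) (f : op R T) : psd_op f ->
  exists M : T -> 'I_#|T| -> C, f = kgram M.
Proof.
move=> /spectral_dec_exists[E [p [/spectral_dec_kgram fE _]]].
by exists (E ** kdiag (fun i => Num.sqrt (p i))).
Qed.

(** Frees the entropy from the particular eigenbasis in its definition; the factor [ln 2] passes to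
    natural logarithms. *)
Lemma vN_entropy_spectral (T I : finType) (f : op R T) (E : T -> I -> C) (p : I -> R) :
  spectral_dec f E p -> vN_entropy f * ln 2 = - \sum_i p i * ln (p i).
Proof.
move=> sE; have pf : psd_op f by rewrite (spectral_dec_kgram sE); apply: psd_kgram.
have [G [q [sG ->]]] := spectral_dec_exists pf.
rewrite mulNr mulr_suml; congr (- _).
rewrite -(spectral_dec_unique (fun x => x * ln x) sG sE).
by apply: eq_bigr => j _; rewrite xlog2xE divfK// gt_eqF// ln2_gt0.
Qed.

Definition kconj (T U : finType) (f : T -> U -> C) : T -> U -> C :=
  fun x y => (f x y)^*.
Definition ktrans (T U : finType) (f : T -> U -> C) : U -> T -> C := fun x y => f y x.

Lemma kconjM (T U V : finType) (f : T -> U -> C) (g : U -> V -> C) :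
  kconj (f ** g) = kconj f ** kconj g.
Proof.
apply: funext => x; apply: funext => y; rewrite /kconj /kmul rmorph_sum.
by apply: eq_bigr => z _; rewrite rmorphM.
Qed.

(* [M M^*] and the conjugate of [M^* M] have the same nonzero spectrum. *)
Lemma vN_entropy_schmidt (T U : finType) (M : T -> U -> C) :
  vN_entropy (kgram (ktrans M)) = vN_entropy (kgram M).
Proof.
have [E [p [sE _]]] := spectral_dec_exists (psd_kgram M).
have [V [q [sV _]]] := spectral_dec_exists (psd_kgram (ktrans M)).
have l2 : ln 2 != 0 :> R by rewrite gt_eqF// ln2_gt0.
apply: (mulIf l2); rewrite (vN_entropy_spectral sE) (vN_entropy_spectral sV).
congr (- _); have [[E1 E2] p0 fE] := sE; have [[V1 V2] q0 fV] := sV.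
(* [M] in the eigenbases of the two Gram kernels, so that [b b^*] and [b^* b] are diagonal. [V] is
   conjugated because [kgram (ktrans M)] is the conjugate of [M^* M]. *)
pose b := E^a ** M ** kconj V.
have kconj1 (W : finType) : kconj (@kone R W) = @kone R W.
  by apply: funext => x; apply: funext => y; rewrite /kconj /kone rmorph_nat.
have bb1 : b ** b^a = kdiag p.
  have VV : kconj V ** (kconj V)^a = @kone R U.
    by rewrite -[(kconj V)^a]/(kconj V^a) -kconjM V2 kconj1.
  rewrite /b !kadjM kadjK !kmulA -(kmulA _ (kconj V)) VV kmul1.
  rewrite -(kmulA _ M) -/(kgram M) fE !kmulA E1 kmul1l.
  by rewrite -kmulA E1 kmul1.
have bb2 : b^a ** b = kdiag q.
  rewrite /b !kadjM kadjK !kmulA -(kmulA _ E) E2 kmul1.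
  have -> : (kconj V)^a ** M^a ** M ** kconj V = kconj (V^a ** kgram (ktrans M) ** V).
    rewrite 2!kconjM -(kmulA _ M^a); congr (_ ** _ ** _).
    rewrite /kgram kconjM; congr (_ ** _); apply: funext => x; apply: funext => y.
    by rewrite /kconj /kadj conjCK.
  rewrite fV !kmulA V1 kmul1l -kmulA V1 kmul1.
  apply: funext => x; apply: funext => y.
  by rewrite /kconj /kdiag rmorphM/= conjC_real rmorph_nat.
have pE i : p i = \sum_j sqnorm (b i j).
  apply: (@complexI R); rewrite -(kgramE b) /kgram bb1.
  by rewrite /kdiag eqxx mulr1.
have qE j : q j = \sum_i sqnorm (b i j).
  under eq_bigr do rewrite -sqnorm_conj.
  apply: (@complexI R); rewrite -(kgramE b^a) /kgram kadjK bb2.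
  by rewrite /kdiag eqxx mulr1.
have eig i j : (p i)%:C * b i j = b i j * (q j)%:C.
  by rewrite -kmul_diag -bb1 -kmulA bb2 kmul_diagr.
(* The eigenvalues [p] and [q] are the row and column sums of the squared moduli of [b], and
   [p i = q j] wherever [b i j] is nonzero. *)
rewrite [RHS](eq_bigr (fun i => \sum_j sqnorm (b i j) * ln (p i))); last first.
  by move=> i _; rewrite {1}pE mulr_suml.
rewrite exchange_big/=; apply: eq_bigr => j _.
rewrite {1}qE mulr_suml; apply: eq_bigr => i _.
have [->|aN] := eqVneq (b i j) 0; first by rewrite sqnorm0 !mul0r.
by have := eig i j; rewrite mulrC => /(mulfI aN)/complexI ->.
Qed.

End Entropy.

(** * Relative entropy and its monotonicity *)

Section Relative.
Variable R : realType.
Local Notation C := R[i].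

Definition ksum (K T U : finType) (F : K -> T -> U -> C) : T -> U -> C :=
  fun x y => \sum_k F k x y.

Lemma kmul_suml (K T U V : finType) (F : K -> T -> U -> C) (g : U -> V -> C) :
  ksum F ** g = ksum (fun k => F k ** g).
Proof.
apply: funext => x; apply: funext => y; rewrite /ksum /kmul exchange_big/=.
by apply: eq_bigr => z _; rewrite mulr_suml.
Qed.

Lemma kmul_sumr (K T U V : finType) (F : K -> U -> V -> C) (g : T -> U -> C) :
  g ** ksum F = ksum (fun k => g ** F k).
Proof.
apply: funext => x; apply: funext => y; rewrite /ksum /kmul exchange_big/=.
by apply: eq_bigr => z _; rewrite mulr_sumr.
Qed.

Lemma kadj_sum (K T U : finType) (F : K -> T -> U -> C) :
  (ksum F)^a = ksum (fun k => (F k)^a).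
Proof.
by apply: funext => x; apply: funext => y; rewrite /kadj /ksum rmorph_sum.
Qed.

Lemma ktr_sum (K T : finType) (F : K -> op R T) : ktr (ksum F) = \sum_k ktr (F k).
Proof. by rewrite /tr_op exchange_big. Qed.

Lemma eq_ksum (K T U : finType) (F G : K -> T -> U -> C) : F =1 G -> ksum F = ksum G.
Proof. by move=> /funext ->. Qed.

(* [Tr (f ln g)] for [g] with spectral decomposition [(G, q)]. *)
Definition cross_ln (T J : finType) (f : op R T) (G : T -> J -> C) (q : J -> R) : R :=
  \sum_j Re ((G^a ** f ** G) j j) * ln (q j).

(** For positive [f] the diagonal entry is nonnegative, so this says that [f] vanishes on the kernel
    of [g]. *)
Definition supported (T J : finType) (f : op R T) (G : T -> J -> C) (q : J -> R) :=
  forall j, q j = 0 -> Re ((G^a ** f ** G) j j) <= 0.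

Lemma supported_overlap (T I J : finType) (f g : op R T)
    (E : T -> I -> C) (p : I -> R) (G : T -> J -> C) (q : J -> R) :
  spectral_dec f E p -> spectral_dec g G q -> supported f G q ->
  forall i j, q j = 0 -> overlap E G i j * p i = 0.
Proof.
move=> sE sG sup i j qj; have := sup j qj; rewrite (diag_overlap G sE)/=.
have [_ p0 _] := sE; move=> le0.
have pos k : 0 <= p k * overlap E G k j by rewrite mulr_ge0// sqnorm_ge0.
have : \sum_k p k * overlap E G k j = 0.
  by apply/eqP; rewrite eq_le le0 sumr_ge0.
by move=> /psumr_eq0P h; rewrite mulrC h// => k _; apply: pos.
Qed.

(** The left side is the relative entropy of [f] and [g] in natural logarithms; unit row sums of
    [overlap] recover the trace of [f ln f]. *)
Lemma relative_entropyE (T I J : finType) (f g : op R T)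
    (E : T -> I -> C) (p : I -> R) (G : T -> J -> C) (q : J -> R) :
  spectral_dec f E p -> spectral_dec g G q ->
  \sum_i \sum_j overlap E G i j * (p i * (ln (p i) - ln (q j))) =
  - vN_entropy f * ln 2 - cross_ln f G q.
Proof.
move=> sE sG; rewrite mulNr (vN_entropy_spectral sE) opprK.
have uO := overlap_unitary sE sG.
rewrite /cross_ln (eq_bigr (fun i => p i * ln (p i) -
    \sum_j p i * overlap E G i j * ln (q j))); last first.
  move=> i _; rewrite -[X in X - _]mul1r -(unitary_row uO i) mulr_suml -sumrB.
  by apply: eq_bigr => j _; rewrite /overlap; ring.
rewrite sumrB exchange_big/=; congr (_ - _); apply: eq_bigr => j _.
by rewrite (diag_overlap G sE)/= mulr_suml.
Qed.

Lemma ktr_spectral (T I J : finType) (f g : op R T)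
    (E : T -> I -> C) (p : I -> R) (G : T -> J -> C) (q : J -> R) :
  spectral_dec f E p -> spectral_dec g G q ->
  Re (ktr f) = \sum_i \sum_j overlap E G i j * p i.
Proof.
move=> sE sG; have uO := overlap_unitary sE sG.
have [[E1 E2] _ fE] := sE.
have -> : ktr f = \sum_i (p i)%:C.
  rewrite fE ktrC kmulA E1 kmul1l /tr_op.
  by apply: eq_bigr => i _; rewrite /kdiag eqxx mulr1.
rewrite Re_sum; apply: eq_bigr => i _.
by rewrite -mulr_suml /overlap unitary_row// mul1r.
Qed.

(* Data processing: [a] plays the role of the dual (Heisenberg) map. *)
Lemma relative_entropy_mono (T T' K I J I' J' : finType) (f g : op R T)
    (E : T -> I -> C) (p : I -> R) (G : T -> J -> C) (q : J -> R)
    (f' g' : K -> op R T')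
    (E' : K -> T' -> I' -> C) (p' : K -> I' -> R)
    (G' : K -> T' -> J' -> C) (q' : K -> J' -> R)
    (a : (K -> op R T') -> op R T) :
  spectral_dec f E p -> spectral_dec g G q -> supported f G q ->
  (forall k, spectral_dec (f' k) (E' k) (p' k)) ->
  (forall k, spectral_dec (g' k) (G' k) (q' k)) ->
  (forall k, supported (f' k) (G' k) (q' k)) ->
  Re (ktr f) = \sum_k Re (ktr (f' k)) ->
  (forall s F, 0 < s <= 1 ->
    \sum_k variational s (f' k) (g' k) (F k) <= variational s f g (a F)) ->
  \sum_k (- vN_entropy (f' k) * ln 2 - cross_ln (f' k) (G' k) (q' k)) <=
  - vN_entropy f * ln 2 - cross_ln f G q.
Proof.
move=> sE sG sup sE' sG' sup' tr_eq var_le.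
have [_ p0 _] := sE; have [_ q0 _] := sG.
rewrite -(relative_entropyE sE sG).
under eq_bigr => k _ do rewrite -(relative_entropyE (sE' k) (sG' k)) pair_bigA/=.
rewrite !pair_bigA/=.
apply: (@rel_le_of_resolvents R _ _ (fun x => overlap E G x.1 x.2)
  (fun x => p x.1) (fun x => q x.2)
  (fun y => overlap (E' y.1) (G' y.1) y.2.1 y.2.2)
  (fun y => p' y.1 y.2.1) (fun y => q' y.1 y.2.2)).
- by move=> x; apply: sqnorm_ge0.
- by [].
- by [].
- by case=> i j /=; apply: supported_overlap sE sG sup i j.
- by move=> x; apply: sqnorm_ge0.
- by case=> k [i j] /=; have [_ h _] := sE' k.
- by case=> k [i j] /=; have [_ h _] := sG' k.
- by case=> k [i j] /=; apply: supported_overlap (sE' k) (sG' k) (sup' k) i j.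
- rewrite -(pair_bigA _ (fun i j => overlap E G i j * p i))/=.
  rewrite -(ktr_spectral sE sG) tr_eq.
  rewrite -(pair_bigA _ (fun k z => overlap (E' k) (G' k) z.1 z.2 * p' k z.1))/=.
  apply: eq_bigr => k _; rewrite (ktr_spectral (sE' k) (sG' k)).
  by rewrite pair_bigA.
- move=> s s01.
  rewrite -(pair_bigA _ (fun i j => overlap E G i j * (p i ^+ 2 / mix s (p i) (q j))))/=.
  rewrite -(pair_bigA _ (fun k z => overlap (E' k) (G' k) z.1 z.2 *
     (p' k z.1 ^+ 2 / mix s (p' k z.1) (q' k z.2))))/=.
  (* The optimal kernels on the output side are sent by [a] to a competitor on the input side. *)
  have [F FE] := boolp.choice (fun k => variational_attained (sE' k) (sG' k) s).
  apply: (@le_trans _ _ (variational s f g (a F))).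
    apply: le_trans (var_le s F s01); apply: ler_sum => k _.
    by rewrite FE pair_bigA.
  apply: variational_le => //; exact: supported_overlap sE sG sup.
Qed.

Lemma psd_diag_ge0 (T I : finType) (f : op R T) (G : T -> I -> C) i :
  psd_op f -> 0 <= (G^a ** f ** G) i i.
Proof.
case=> _ /(_ (fun x => G x i)) h; rewrite /kmul.
apply: le_trans h _; rewrite exchange_big/= le_eqVlt; apply/orP; left; apply/eqP.
by apply: eq_bigr => y _; rewrite mulr_suml.
Qed.

Lemma psd_diag_Re_ge0 (T I : finType) (f : op R T) (G : T -> I -> C) i :
  psd_op f -> 0 <= Re ((G^a ** f ** G) i i).
Proof. by move=> /(psd_diag_ge0 G i); rewrite lecE => /andP[]. Qed.

Lemma psd_conj (T I : finType) (f : op R T) (G : T -> I -> C) :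
  psd_op f -> psd_op (G^a ** f ** G).
Proof.
move=> /psd_op_kgram[M ->].
have -> : G^a ** kgram M ** G = kgram (G^a ** M) by rewrite /kgram !kadjM kadjK !kmulA.
exact: psd_kgram.
Qed.

Lemma psd_ksum (K T : finType) (F : K -> op R T) :
  (forall k, psd_op (F k)) -> psd_op (ksum F).
Proof.
move=> pF; split=> [x y|v].
  by rewrite /ksum rmorph_sum; apply: eq_bigr => k _; have [h _] := pF k; rewrite h.
have -> : \sum_x \sum_y (v x)^* * ksum F x y * v y =
    \sum_k \sum_x \sum_y (v x)^* * F k x y * v y.
  rewrite [RHS]exchange_big/=; apply: eq_bigr => x _; rewrite [RHS]exchange_big/=.
  by apply: eq_bigr => y _; rewrite /ksum mulr_sumr mulr_suml.
by apply: sumr_ge0 => k _; have [_ h] := pF k; apply: h.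
Qed.

Section Ensemble.
Variables (K T J : finType) (F : K -> op R T) (G : T -> J -> C) (q : J -> R).
Hypotheses (pF : forall k, psd_op (F k)) (sG : spectral_dec (ksum F) G q).

Lemma diag_ksum j : \sum_k Re ((G^a ** F k ** G) j j) = q j.
Proof.
have [[G1 G2] _ fG] := sG.
rewrite -Re_sum -[\sum_k _]/(ksum (fun k => G^a ** F k ** G) j j).
rewrite -(kmul_suml (fun k => G^a ** F k)) -kmul_sumr fG !kmulA G1 kmul1l.
by rewrite -kmulA G1 kmul1 /kdiag eqxx mulr1.
Qed.

(** Each member of a positive ensemble is dominated by the sum of the ensemble. *)
Lemma supported_ksum k (c : R) : c != 0 -> supported (F k) G (fun j => c * q j).
Proof.
move=> c0 j /eqP; rewrite mulf_eq0 (negPf c0) => /eqP qj; rewrite -qj -diag_ksum.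
by rewrite (bigD1 k)//= lerDl sumr_ge0// => l _; apply: psd_diag_Re_ge0.
Qed.

(** Linearity in the first argument reduces the sum to the trace of [s ln (c s)] with [s = ksum F].
    The factor [c] is 1 for the partial trace and the overlap bound for measurements. *)
Lemma cross_ln_ksum (c : R) : 0 < c ->
  \sum_k cross_ln (F k) G (fun j => c * q j) =
  ln c * Re (ktr (ksum F)) - vN_entropy (ksum F) * ln 2.
Proof.
move=> c0; have [_ q0 _] := sG.
rewrite (vN_entropy_spectral sG) opprK (ktr_spectral sG sG).
rewrite /cross_ln exchange_big/= [X in _ * X]exchange_big/= mulr_sumr -big_split/=.
apply: eq_bigr => j _.
rewrite -mulr_suml diag_ksum.
have -> : \sum_i overlap G G i j * q i = q j.
  have [[G1 _] _ _] := sG.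
  rewrite (bigD1 j)//= big1 => [|i /negPf ij]; rewrite /overlap G1 /kone ?ij.
    by rewrite eqxx sqnorm1 mul1r addr0.
  by rewrite sqnorm0 mul0r.
have [->|qN] := eqVneq (q j) 0; first by rewrite !mul0r mulr0 addr0.
have qj : 0 < q j by rewrite lt_neqAle eq_sym qN/=.
by rewrite lnM ?posrE//; ring.
Qed.

End Ensemble.

Definition kscale (T U : finType) (c : R) (f : T -> U -> C) : T -> U -> C :=
  fun x y => c%:C * f x y.

Lemma spectral_dec_scale (T I : finType) (c : R) (f : op R T) (E : T -> I -> C)
    (p : I -> R) : 0 <= c -> spectral_dec f E p ->
  spectral_dec (kscale c f) E (fun i => c * p i).
Proof.
move=> c0 [uE p0 fE]; split=> // [i|]; first by rewrite mulr_ge0.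
apply: funext => x; apply: funext => y; rewrite /kscale fE {1 3}/kmul mulr_sumr.
by apply: eq_bigr => i _; rewrite !kmul_diagr rmorphM/=; ring.
Qed.

End Relative.

(** * Partial traces and conditional entropy *)

Lemma sum_pair (V : nmodType) (S Q : finType) (F : S * Q -> V) :
  \sum_x F x = \sum_c \sum_r F (c, r).
Proof. by rewrite pair_bigA; apply: eq_bigr => -[]. Qed.

Section PartialTrace.
Variable R : realType.
Local Notation C := R[i].

Definition ptr2 (S Q : finType) (f : op R (S * Q)%type) : op R S :=
  fun c c' => \sum_r f (c, r) (c', r).

Definition ktens (S Q : finType) (F : op R S) : op R (S * Q)%type :=
  fun x y => F x.1 y.1 * (x.2 == y.2)%:R.

Lemma sum_pair_delta (S Q : finType) (r : Q) (F : S -> Q -> C) :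
  \sum_(y : S * Q) F y.1 y.2 * (y.2 == r)%:R = \sum_c F c r.
Proof.
rewrite -(pair_bigA _ (fun c r' => F c r' * (r' == r)%:R))/=.
apply: eq_bigr => c _; rewrite (bigD1 r)//= eqxx mulr1 big1 ?addr0// => i /negPf->.
by rewrite mulr0.
Qed.

Lemma ktensM (S Q : finType) (F G : op R S) :
  @ktens S Q (F ** G) = ktens F ** ktens G.
Proof.
apply: funext => x; apply: funext => y; rewrite /ktens /kmul.
pose H c r := F x.1 c * (G c y.1 * (r == y.2)%:R).
transitivity (\sum_z H z.1 z.2 * (z.2 == x.2)%:R); last first.
  by apply: eq_bigr => z _; rewrite /H [x.2 == _]eq_sym; ring.
by rewrite sum_pair_delta mulr_suml; apply: eq_bigr => z _; rewrite /H eq_sym mulrA.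
Qed.

Lemma ktens_adj (S Q : finType) (F : op R S) : (@ktens S Q F)^a = ktens F^a.
Proof.
apply: funext => x; apply: funext => y; rewrite /ktens /kadj rmorphM/=.
by rewrite rmorph_nat eq_sym.
Qed.

(** [ktens] is the dual of [ptr2]. As it also respects products and adjoints, it preserves the
    variational functional exactly. *)
Lemma ktr_ktens (S Q : finType) (f : op R (S * Q)%type) (F : op R S) :
  ktr (f ** ktens F) = ktr (ptr2 f ** F).
Proof.
rewrite /tr_op sum_pair.
apply: eq_bigr => c _; rewrite /kmul /ktens /ptr2.
pose H r c' r' := f (c, r) (c', r') * F c' c.
transitivity (\sum_r \sum_c' H r c' r).
  apply: eq_bigr => r _; rewrite -sum_pair_delta; apply: eq_bigr => -[c' r'] _.
  by rewrite mulrA.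
by rewrite exchange_big/=; apply: eq_bigr => c' _; rewrite mulr_suml.
Qed.

Lemma ktr_ptr2 (S Q : finType) (f : op R (S * Q)%type) : ktr (ptr2 f) = ktr f.
Proof. by rewrite /tr_op sum_pair. Qed.

Lemma ptr2_kgram (S Q U : finType) (M : S * Q -> U -> C) :
  ptr2 (kgram M) = kgram (fun c (z : Q * U) => M (c, z.1) z.2).
Proof.
apply: funext => c; apply: funext => c'.
by rewrite /ptr2 /kgram /kmul /kadj sum_pair.
Qed.

Lemma psd_ptr2 (S Q : finType) (f : op R (S * Q)%type) : psd_op f -> psd_op (ptr2 f).
Proof. by move=> /psd_op_kgram[M ->]; rewrite ptr2_kgram; apply: psd_kgram. Qed.

Lemma ptr2_ksum (K S Q : finType) (F : K -> op R (S * Q)%type) :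
  ptr2 (ksum F) = ksum (fun k => ptr2 (F k)).
Proof.
by apply: funext => c; apply: funext => c'; rewrite /ptr2 /ksum exchange_big.
Qed.

(** With a classical register holding [k], this says that the conditional entropy of the register
    given [S] and [Q] is at most that given [S]. It is monotonicity of the relative entropy of [F k]
    and [ksum F] under [ptr2], summed over [k]. *)
Lemma cond_entropy_ptr2 (K S Q : finType) (F : K -> op R (S * Q)%type) :
  (forall k, psd_op (F k)) ->
  \sum_k vN_entropy (F k) - vN_entropy (ksum F) <=
  \sum_k vN_entropy (ptr2 (F k)) - vN_entropy (ptr2 (ksum F)).
Proof.
move=> pF; have pF' k := psd_ptr2 (pF k).
have [G [q [sG _]]] := spectral_dec_exists (psd_ksum pF).
have [G' [q' [sG' _]]] := spectral_dec_exists (psd_ksum pF').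
have q1 (I : finType) (v : I -> R) : v = (fun j => 1 * v j).
  by apply: funext => j; rewrite mul1r.
have le_k k : - vN_entropy (ptr2 (F k)) * ln 2 - cross_ln (ptr2 (F k)) G' q' <=
    - vN_entropy (F k) * ln 2 - cross_ln (F k) G q.
  have [E [p [sE _]]] := spectral_dec_exists (pF k).
  have [E' [p' [sE' _]]] := spectral_dec_exists (pF' k).
  (* The partial trace has a single output branch, hence the index type [unit]. *)
  have := @relative_entropy_mono R _ _ unit _ _ _ _ _ _ _ _ _ _
    (fun=> ptr2 (F k)) (fun=> ksum (fun k => ptr2 (F k))) (fun=> E') (fun=> p')
    (fun=> G') (fun=> q') (fun L => ktens (L tt)) sE sG.
  rewrite !(big_pred1 tt); [|by case|by case]; apply=> //.
  - by rewrite (q1 _ q); apply: (supported_ksum pF sG k (oner_neq0 _)).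
  - by move=> _; rewrite (q1 _ q'); apply: (supported_ksum pF' sG' k (oner_neq0 _)).
  - by rewrite ktr_ptr2.
  - move=> s L _; rewrite (big_pred1 tt); last by case.
    rewrite /variational !ktens_adj -!ktensM !ktr_ktens.
    by rewrite ptr2_ksum.
have : \sum_k (- vN_entropy (ptr2 (F k)) * ln 2 - cross_ln (ptr2 (F k)) G' q') <=
    \sum_k (- vN_entropy (F k) * ln 2 - cross_ln (F k) G q).
  by apply: ler_sum => k _.
rewrite !sumrB (q1 _ q) (q1 _ q') (cross_ln_ksum sG ltr01).
rewrite (cross_ln_ksum sG' ltr01) !ln1 !mul0r !add0r.
rewrite ptr2_ksum -!mulr_suml.
move: (vN_entropy (ksum F)) (vN_entropy (ksum _)) => v v'.
rewrite !opprK -!mulrDl ler_pM2r ?ln2_gt0//.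
have sumN (u : K -> R) : \sum_k - u k = - \sum_k u k by rewrite sumrN.
rewrite (sumN (fun k => vN_entropy (F k))) (sumN (fun k => vN_entropy (ptr2 (F k)))).
lra.
Qed.

End PartialTrace.

(** * Measurements as block decompositions *)

Section Measurement.
Variable R : realType.
Local Notation C := R[i].

(** Isometries from [B] into [T] whose ranges are orthogonal and together fill [T]. *)
Definition isometric_sum (K T B : finType) (J : K -> T -> B -> C) :=
  (forall k l, (J k)^a ** J l = kscale (k == l)%:R (@kone R B)) /\
  ksum (fun k => J k ** (J k)^a) = @kone R T.

(** The unnormalised state on [B] conditional on outcome [k]. *)
Definition kblock (K T B : finType) (J : K -> T -> B -> C) (f : op R T) (k : K) :
  op R B := (J k)^a ** f ** J k.

Definition kembed (K T B : finType) (J : K -> T -> B -> C) (F : K -> op R B) :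
  op R T := ksum (fun k => J k ** F k ** (J k)^a).

Lemma kscale_mull (T U V : finType) (c : R) (f : T -> U -> C) (g : U -> V -> C) :
  kscale c f ** g = kscale c (f ** g).
Proof.
apply: funext => x; apply: funext => y; rewrite /kscale /kmul mulr_sumr.
by apply: eq_bigr => z _; rewrite mulrA.
Qed.

Lemma kscale_mulr (T U V : finType) (c : R) (f : T -> U -> C) (g : U -> V -> C) :
  f ** kscale c g = kscale c (f ** g).
Proof.
apply: funext => x; apply: funext => y; rewrite /kscale /kmul mulr_sumr.
by apply: eq_bigr => z _; rewrite mulrCA.
Qed.

Lemma ktr_scale (T : finType) (c : R) (f : op R T) : ktr (kscale c f) = c%:C * ktr f.
Proof. by rewrite /tr_op mulr_sumr. Qed.

Lemma ksum_delta (K T U : finType) (l : K) (F : K -> T -> U -> C) :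
  ksum (fun k => kscale (k == l)%:R (F k)) = F l.
Proof.
apply: funext => x; apply: funext => y; rewrite /ksum /kscale (bigD1 l)//= eqxx.
rewrite rmorph1 mul1r big1 ?addr0// => k /negPf->.
by rewrite rmorph0 mul0r.
Qed.

Section IsometricSum.
Variables (K T B : finType) (J : K -> T -> B -> C).
Hypothesis isoJ : isometric_sum J.

Lemma kembedM (F G : K -> op R B) :
  kembed J F ** kembed J G = kembed J (fun k => F k ** G k).
Proof.
have [J1 J2] := isoJ.
rewrite /kembed kmul_suml; apply: eq_ksum => k; rewrite kmul_sumr.
rewrite -[RHS](ksum_delta k (fun l => J k ** (F k ** G l) ** (J l)^a)).
apply: eq_ksum => l.
by rewrite !kmulA -(kmulA _ (J k)^a) J1 kscale_mulr kmul1 eq_sym !kscale_mull.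
Qed.

Lemma kembed_adj (F : K -> op R B) : (kembed J F)^a = kembed J (fun k => (F k)^a).
Proof.
rewrite /kembed kadj_sum; apply: eq_ksum => k.
by rewrite !kadjM kadjK kmulA.
Qed.

Lemma ktr_kembed (f : op R T) (F : K -> op R B) :
  ktr (f ** kembed J F) = \sum_k ktr (kblock J f k ** F k).
Proof.
rewrite /kembed kmul_sumr ktr_sum; apply: eq_bigr => k _.
by rewrite /kblock !kmulA ktrC !kmulA.
Qed.

(** Eigenvectors of the blocks, pushed forward by the isometries, form an eigenbasis of the direct
    sum. *)
Lemma spectral_dec_kembed (I : finType) (F : K -> op R B) (E : K -> B -> I -> C)
    (p : K -> I -> R) : (forall k, spectral_dec (F k) (E k) (p k)) ->
  spectral_dec (kembed J F) (fun x (z : K * I) => (J z.1 ** E z.1) x z.2)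
    (fun z => p z.1 z.2).
Proof.
move=> sF; have [J1 J2] := isoJ; split.
- split.
    apply: funext => -[k i]; apply: funext => -[l j].
    have -> : (fun x (z : K * I) => (J z.1 ** E z.1) x z.2)^a **
       (fun x (z : K * I) => (J z.1 ** E z.1) x z.2) =
       fun z z' => ((J z.1 ** E z.1)^a ** (J z'.1 ** E z'.1)) z.2 z'.2 by [].
    rewrite /= kadjM !kmulA -(kmulA _ (J k)^a) J1 kscale_mulr kmul1 kscale_mull.
    rewrite /kscale /kone xpair_eqE; have [->|] := eqVneq k l; last first.
      by rewrite /= rmorph0 mul0r.
    by have [[-> _] _ _] := sF l; rewrite rmorph1 mul1r.
  rewrite -J2; apply: funext => x; apply: funext => y; rewrite /ksum {1}/kmul.
  rewrite -(pair_bigA _ (fun k i => (J k ** E k) x i * ((J k ** E k) y i)^*))/=.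
  apply: eq_bigr => k _.
  rewrite -[LHS]/(((J k ** E k) ** (J k ** E k)^a) x y).
  by rewrite kadjM kmulA -(kmulA (J k)); have [[_ ->] _ _] := sF k; rewrite kmul1.
- by move=> [k i]; have [_ h _] := sF k.
- apply: funext => x; apply: funext => y; rewrite /kembed /ksum [RHS]/kmul.
  rewrite -(pair_bigA _ (fun k i => ((fun x (z : K * I) => (J z.1 ** E z.1) x z.2)
    ** kdiag (fun z => p z.1 z.2)) x (k, i) * ((J k ** E k) y i)^*))/=.
  apply: eq_bigr => k _; have [_ _ ->] := sF k.
  have -> : J k ** (E k ** kdiag (p k) ** (E k)^a) ** (J k)^a =
     (J k ** E k) ** kdiag (p k) ** (J k ** E k)^a by rewrite kadjM !kmulA.
  by rewrite {1}/kmul; apply: eq_bigr => i _; rewrite !kmul_diagr.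
Qed.

Lemma vN_entropy_kembed (F : K -> op R B) : (forall k, psd_op (F k)) ->
  vN_entropy (kembed J F) = \sum_k vN_entropy (F k).
Proof.
move=> pF; have [E] := boolp.choice (fun k => spectral_dec_exists (pF k)).
move=> /boolp.choice[p /all_and2[sF _]].
apply: (mulIf (lt0r_neq0 (@ln2_gt0 R))).
rewrite (vN_entropy_spectral (spectral_dec_kembed sF)).
rewrite -(pair_bigA _ (fun k i => p k i * ln (p k i)))/= mulr_suml -sumrN.
by apply: eq_bigr => k _; rewrite (vN_entropy_spectral (sF k)).
Qed.

Lemma ktr_kblock (f : op R T) : ktr f = \sum_k ktr (kblock J f k).
Proof.
have [_ J2] := isoJ.
rewrite -{1}[f]kmul1 -J2.
have -> : ksum (fun k => J k ** (J k)^a) = kembed J (fun=> @kone R B).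
  by apply: eq_ksum => k; rewrite kmul1.
by rewrite ktr_kembed; apply: eq_bigr => k _; rewrite kmul1.
Qed.

End IsometricSum.

Lemma psd_ktr_ge0 (T U : finType) (f : op R T) (F : T -> U -> C) :
  psd_op f -> 0 <= Re (ktr (f ** (F ** F^a))).
Proof.
move=> pf; rewrite kmulA ktrC kmulA /tr_op Re_sum.
by apply: sumr_ge0 => x _; apply: psd_diag_Re_ge0.
Qed.

(** Monotonicity is applied to [f] and its [Z]-pinching, with the [J]-blocks as output. On the
    output side the second argument is enlarged to [c] times the marginal, which only lowers the
    variational functional. *)
Lemma entropic_uncertainty_blocks (K L T B : finType) (J : K -> T -> B -> C)
    (Z : L -> T -> B -> C) (u : K -> L -> C) (c : R) (f : op R T) :
  isometric_sum J -> isometric_sum Z -> 0 < c ->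
  (forall k l, (J k)^a ** Z l = fun b b' => u k l * @kone R B b b') ->
  (forall k l, sqnorm (u k l) <= c) ->
  psd_op f -> Re (ktr f) = 1 ->
  ksum (kblock J f) = ksum (kblock Z f) ->
  - ln c <= (\sum_l vN_entropy (kblock Z f l) - vN_entropy f
             + \sum_k vN_entropy (kblock J f k)
             - vN_entropy (ksum (kblock J f))) * ln 2.
Proof.
move=> isoJ isoZ c0 JZ uc pf trf JZsum.
have pJ k : psd_op (kblock J f k) by apply: psd_conj.
have pZ l : psd_op (kblock Z f l) by apply: psd_conj.
have [E [p [sE _]]] := spectral_dec_exists pf.
have [EZ] := boolp.choice (fun l => spectral_dec_exists (pZ l)).
move=> /boolp.choice[r /all_and2[sZ _]].
have [EJ] := boolp.choice (fun l => spectral_dec_exists (pJ l)).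
move=> /boolp.choice[t /all_and2[sJ _]].
have [V [v [sV _]]] := spectral_dec_exists (psd_ksum pJ).
have sG := spectral_dec_kembed isoZ sZ.
set G := (fun x z => _) in sG; set q := (fun z => _) in sG.
(* [f] and its pinching have the same diagonal in the eigenbasis of the pinching. This gives the
   support condition and turns the cross term into the entropies of the [Z]-blocks. *)
have diagG l i : (G^a ** f ** G) (l, i) (l, i) = (r l i)%:C.
  rewrite -[LHS]/(((Z l ** EZ l)^a ** f ** (Z l ** EZ l)) i i) kadjM !kmulA.
  rewrite -(kmulA _ (Z l)^a) -(kmulA _ _ (Z l)) -/(kblock Z f l).
  have [[Z1 _] _ ->] := sZ l.
  by rewrite !kmulA Z1 kmul1l -kmulA Z1 kmul1 /kdiag eqxx mulr1.
have sVc : forall k : K, spectral_dec (kscale c (ksum (kblock J f))) V (fun j => c * v j).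
  by move=> _; apply: spectral_dec_scale => //; apply: ltW.
have : \sum_k (- vN_entropy (kblock J f k) * ln 2
              - cross_ln (kblock J f k) V (fun j => c * v j)) <=
    - vN_entropy f * ln 2 - cross_ln f G q.
  apply: (@relative_entropy_mono R _ _ _ _ _ _ _ _ _ _ _ _ _ _ _ _ _
    (fun=> V) (fun=> fun j => c * v j) (kembed J) sE sG _ sJ sVc).
  - by move=> [l i]; rewrite diagG/= /q/= => ->.
  - by move=> k; apply: (supported_ksum pJ sV k); rewrite gt_eqF.
  - by rewrite (ktr_kblock isoJ) Re_sum.
  - move=> s F /andP[s0 _].
    rewrite /variational (kembed_adj J) !(kembedM isoJ) !ktr_kembed !Re_sum.
    rewrite !mulr_sumr -!sumrB; apply: ler_sum => k _.
    rewrite lerD2r lerD2l lerN2 ler_pM2l//.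
    rewrite kscale_mull ktr_scale Re_mulC JZsum.
    (* As [(J k)^a ** Z l] is a multiple of the identity, measuring the pinched state mixes the
       [Z]-blocks with weights [sqnorm (u k l)], each at most [c]. *)
    have -> : kblock J (kembed Z (kblock Z f)) k =
        ksum (fun l => kscale (sqnorm (u k l)) (kblock Z f l)).
      rewrite /kblock /kembed kmul_sumr kmul_suml; apply: eq_ksum => l.
      have ZJ : (Z l)^a ** J k = fun b b' => (u k l)^* * @kone R B b b'.
        rewrite -[LHS]kadjK kadjM kadjK JZ; apply: funext => b; apply: funext => b'.
        by rewrite /kadj rmorphM/= /kone rmorph_nat eq_sym.
      have -> : (J k)^a ** (Z l ** ((Z l)^a ** f ** Z l) ** (Z l)^a) ** J k =
          ((J k)^a ** Z l) ** (kblock Z f l ** ((Z l)^a ** J k)) by rewrite !kmulA.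
      rewrite JZ ZJ -/(kblock Z f l).
      have sl (z : C) (M : op R B) :
          (fun b b' => z * @kone R B b b') ** M = fun b b' => z * M b b'.
        rewrite -{2}[M]kmul1l; apply: funext => b; apply: funext => b'.
        by rewrite /kmul mulr_sumr; apply: eq_bigr => y _; rewrite mulrA.
      have sr (z : C) (M : op R B) :
          M ** (fun b b' => z * @kone R B b b') = fun b b' => z * M b b'.
        rewrite -{2}[M]kmul1; apply: funext => b; apply: funext => b'.
        by rewrite /kmul mulr_sumr; apply: eq_bigr => y _; rewrite mulrCA.
      rewrite sr sl; apply: funext => b; apply: funext => b'.
      by rewrite /kscale -mul_conjC_sqnorm; ring.
    rewrite !kmul_suml !ktr_sum !Re_sum mulr_sumr; apply: ler_sum => l _.
    rewrite kscale_mull ktr_scale Re_mulC ler_wpM2r//.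
    exact: psd_ktr_ge0.
have -> : cross_ln f G q = - \sum_l vN_entropy (kblock Z f l) * ln 2.
  rewrite /cross_ln sum_pair -sumrN; apply: eq_bigr => l _.
  rewrite (vN_entropy_spectral (sZ l)) opprK; apply: eq_bigr => i _.
  by rewrite diagG.
rewrite sumrB (cross_ln_ksum sV c0) ktr_sum -(ktr_kblock isoJ) trf mulr1.
have sumN (u' : K -> R) : \sum_k - u' k = - \sum_k u' k by rewrite sumrN.
rewrite -!mulr_suml (sumN (fun k => vN_entropy (kblock J f k))).
move: (\sum_k _) (\sum_l _) (vN_entropy _) (vN_entropy _) => x y z w.
lra.
Qed.

End Measurement.

(** * Uncertainty relations for two measurements with memory *)

Section Slices.
Variable R : realType.
Local Notation C := R[i].

(** The isometry from [B] that adjoins the vector [psi k] on the measured system. *)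
Definition slice (d : nat) (B : finType) (psi : 'I_d -> vec R 'I_d) (k : 'I_d) :
  ('I_d * B)%type -> B -> C := fun x b => psi k x.1 * (x.2 == b)%:R.

Definition ptr1 (A B : finType) (f : op R (A * B)%type) : op R B :=
  fun b b' => \sum_a f (a, b) (a, b').

(** For square matrices a one-sided inverse is two-sided, so [d] orthonormal vectors in dimension
    [d] are complete. *)
Lemma orthonormal_basis_complete d (psi : 'I_d -> vec R 'I_d) :
  orthonormal_basis psi -> unitary (fun a k => psi k a).
Proof.
move=> on; pose P : 'M[C]_d := \matrix_(k, a) (psi k a)^*.
pose P' : 'M[C]_d := \matrix_(a, k) psi k a.
have PP : P *m P' = 1%:M.
  apply/matrixP => k l; rewrite !mxE -(on k l); apply: eq_bigr => a _.
  by rewrite !mxE.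
split; apply: funext => i; apply: funext => j; rewrite /kmul /kadj /kone.
  by rewrite -on.
have /(congr1 (fun M : 'M[C]__ => M i j)) := mulmx1C PP.
by rewrite !mxE => <-; apply: eq_bigr => k _; rewrite !mxE.
Qed.

Lemma slice_adjM d (B : finType) (psi phi : 'I_d -> vec R 'I_d) k l :
  (@slice d B psi k)^a ** slice phi l =
  fun b b' => qinner (psi k) (phi l) * @kone R B b b'.
Proof.
apply: funext => b; apply: funext => b'.
rewrite /kmul /kadj /slice sum_pair /qinner mulr_suml; apply: eq_bigr => a _ /=.
rewrite (bigD1 b)//= eqxx mulr1 big1 ?addr0 => [|c /negPf ->].
  by rewrite mulrA.
by rewrite mulr0 rmorph0 mul0r.
Qed.

Lemma slice_adj_mulE d (B W : finType) (psi : 'I_d -> vec R 'I_d) k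
    (M : ('I_d * B)%type -> W -> C) b w :
  ((slice psi k)^a ** M) b w = \sum_a (psi k a)^* * M (a, b) w.
Proof.
rewrite /kmul /kadj /slice sum_pair; apply: eq_bigr => a _ /=.
rewrite (bigD1 b)//= eqxx mulr1 big1 ?addr0// => c /negPf ->.
by rewrite mulr0 rmorph0 mul0r.
Qed.

Lemma slice_mulrE d (B W : finType) (psi : 'I_d -> vec R 'I_d) k
    (M : W -> ('I_d * B)%type -> C) w b :
  (M ** slice psi k) w b = \sum_a M w (a, b) * psi k a.
Proof.
rewrite /kmul /slice sum_pair; apply: eq_bigr => a _ /=.
rewrite (bigD1 b)//= eqxx mulr1 big1 ?addr0// => c /negPf ->.
by rewrite !mulr0.
Qed.

Lemma kblock_sliceE d (B : finType) (psi : 'I_d -> vec R 'I_d)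
    (f : op R ('I_d * B)%type) k b b' :
  kblock (slice psi) f k b b' =
  \sum_a \sum_a' (psi k a)^* * f (a, b) (a', b') * psi k a'.
Proof.
rewrite /kblock slice_mulrE exchange_big/=; apply: eq_bigr => a' _.
by rewrite slice_adj_mulE mulr_suml.
Qed.

Lemma slice_mulE d (B W : finType) (psi : 'I_d -> vec R 'I_d) k
    (M : B -> W -> C) x w : (slice psi k ** M) x w = psi k x.1 * M x.2 w.
Proof.
rewrite /kmul /slice (bigD1 x.2)//= eqxx mulr1 big1 ?addr0// => c /negPf cx.
by rewrite eq_sym cx mulr0 mul0r.
Qed.

Lemma slice_mul_adjE d (B W : finType) (psi : 'I_d -> vec R 'I_d) k
    (M : W -> B -> C) w x : (M ** (slice psi k)^a) w x = M w x.2 * (psi k x.1)^*.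
Proof.
rewrite /kmul /kadj /slice (bigD1 x.2)//= eqxx mulr1 big1 ?addr0// => c /negPf cx.
by rewrite eq_sym cx mulr0 rmorph0 mulr0.
Qed.

Lemma isometric_sum_slice d (B : finType) (psi : 'I_d -> vec R 'I_d) :
  orthonormal_basis psi -> isometric_sum (@slice d B psi).
Proof.
move=> on; split=> [k l|].
  rewrite slice_adjM on; apply: funext => b; apply: funext => b'.
  by rewrite /kscale rmorph_nat.
have [_ E2] := orthonormal_basis_complete on.
apply: funext => -[a b]; apply: funext => -[a' b']; rewrite /ksum.
under eq_bigr => k _ do rewrite slice_mul_adjE /slice/= mulrAC.
rewrite -mulr_suml -[X in X * _]/(((fun a k => psi k a) ** (fun a k => psi k a)^a) a a').
by rewrite E2 /kone xpair_eqE -natrM mulnb.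
Qed.

Lemma post_measE d (B : finType) (psi : 'I_d -> vec R 'I_d)
    (f : op R ('I_d * B)%type) :
  post_meas psi f = kembed (slice psi) (kblock (slice psi) f).
Proof.
apply: funext => -[a b]; apply: funext => -[a' b']; rewrite /post_meas /kembed /ksum/=.
apply: eq_bigr => k _; rewrite slice_mul_adjE slice_mulE kblock_sliceE/=.
rewrite mulr_sumr mulr_suml; apply: eq_bigr => a1 _.
rewrite mulr_sumr mulr_suml; apply: eq_bigr => a2 _; rewrite /ketbra.
ring.
Qed.

(** By completeness, forgetting the outcome leaves the memory in its marginal state, whichever basis
    was measured. *)
Lemma ksum_kblock_slice d (B : finType) (psi : 'I_d -> vec R 'I_d)
    (f : op R ('I_d * B)%type) :
  orthonormal_basis psi -> ksum (kblock (slice psi) f) = ptr1 f.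
Proof.
move=> /orthonormal_basis_complete[_ E2].
apply: funext => b; apply: funext => b'; rewrite /ksum /ptr1.
under eq_bigr do rewrite kblock_sliceE.
rewrite exchange_big/=; apply: eq_bigr => a _.
rewrite exchange_big/= (bigD1 a)//= [X in _ + X]big1 ?addr0 => [|a' /negPf aa'].
  have /(congr1 (fun M => M a a)) := E2; rewrite /kmul /kadj /kone eqxx => h.
  rewrite -[RHS]mulr1 -[X in _ * X]h mulr_sumr; apply: eq_bigr => k _; ring.
have /(congr1 (fun M => M a' a)) := E2; rewrite /kmul /kadj /kone aa' => h.
rewrite -[RHS](mulr0 (f (a, b) (a', b'))) -[X in _ * X]h mulr_sumr.
by apply: eq_bigr => k _; ring.
Qed.

Lemma vN_entropy_post_meas d (B : finType) (psi : 'I_d -> vec R 'I_d)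
    (f : op R ('I_d * B)%type) : orthonormal_basis psi -> psd_op f ->
  vN_entropy (post_meas psi f) = \sum_k vN_entropy (kblock (slice psi) f k).
Proof.
move=> on pf; rewrite post_measE vN_entropy_kembed//.
  exact: isometric_sum_slice.
by move=> k; apply: psd_conj.
Qed.

Lemma cmax_ge d (psi phi : 'I_d -> vec R 'I_d) k l :
  sqnorm (qinner (psi k) (phi l)) <= cmax psi phi.
Proof.
by rewrite /cmax (bigD1 k)//= le_max (bigD1 l)//= le_max lexx.
Qed.

(** A row of squared overlaps sums to one, so its entries cannot all be nonpositive. *)
Lemma cmax_gt0 d (psi phi : 'I_d -> vec R 'I_d) : (0 < d)%N ->
  orthonormal_basis psi -> orthonormal_basis phi -> 0 < cmax psi phi.
Proof.
move=> d0 /orthonormal_basis_complete on1 /orthonormal_basis_complete on2.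
pose k : 'I_d := Ordinal d0.
have := unitary_row (unitary_mul (unitary_adj on1) on2) k.
rewrite ltNge => h; apply/negP => c0.
have : \sum_l sqnorm (((fun a k => psi k a)^a ** (fun a k => phi k a)) k l) <= 0.
  by apply: sumr_le0 => l _; apply: le_trans (cmax_ge _ _ k l) c0.
by rewrite h ler10.
Qed.

(** This is [S(X|B) + S(Z|B) >= - log c + S(A|B)] after cancelling one marginal entropy [S(B)]. *)
Lemma bipartite_uncertainty d (B : finType) (psi phi : 'I_d -> vec R 'I_d)
    (f : op R ('I_d * B)%type) : (0 < d)%N ->
  orthonormal_basis psi -> orthonormal_basis phi -> psd_op f -> Re (ktr f) = 1 ->
  - log2 (cmax psi phi) <=
  vN_entropy (post_meas phi f) - vN_entropy f
  + vN_entropy (post_meas psi f) - vN_entropy (ptr1 f).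
Proof.
move=> d0 on1 on2 pf trf.
have := @entropic_uncertainty_blocks R _ _ _ _ (slice psi) (slice phi)
  (fun k l => qinner (psi k) (phi l)) (cmax psi phi) f
  (isometric_sum_slice B on1) (isometric_sum_slice B on2) (cmax_gt0 d0 on1 on2)
  (slice_adjM B psi phi) (cmax_ge psi phi) pf trf.
rewrite !ksum_kblock_slice// => /(_ erefl).
rewrite !vN_entropy_post_meas// /log2 -mulNr ler_pdivrMr//.
exact: ln2_gt0.
Qed.

(* Purity of [Phi] turns entropies on [A B] into entropies on the complement [S Q]. *)
Lemma complement_entropy_le d (B S Q : finType) (phi : 'I_d -> vec R 'I_d)
    (Phi : ('I_d * B)%type -> (S * Q)%type -> C) :
  let Phi' (x : 'I_d * S) (z : B * Q) := Phi (x.1, z.1) (x.2, z.2) in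
  orthonormal_basis phi ->
  vN_entropy (post_meas phi (kgram Phi)) - vN_entropy (kgram Phi) <=
  vN_entropy (post_meas phi (kgram Phi')) - vN_entropy (ptr1 (kgram Phi')).
Proof.
move=> Phi' on.
pose ph k := (slice phi k)^a ** Phi.
have blk k : kblock (slice phi) (kgram Phi) k = kgram (ph k).
  by rewrite /kblock /kgram /ph kadjM kadjK !kmulA.
(* The state of the complement given outcome [k]; it has the entropy of the corresponding block on
   [B]. *)
pose F k := kgram (ktrans (ph k)).
(* Discarding [Q] leaves the state of [S] given the same outcome. *)
have FE k : ptr2 (F k) = kblock (slice phi) (kgram Phi') k.
  apply: funext => c; apply: funext => c'.
  have -> : kblock (slice phi) (kgram Phi') k = kgram ((slice phi k)^a ** Phi').
    by rewrite /kblock /kgram kadjM kadjK !kmulA.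
  transitivity (\sum_q \sum_b ph k b (c, q) * (ph k b (c', q))^*); first by [].
  set M := _ ** Phi'; transitivity (\sum_z M c z * (M c' z)^*); last by [].
  rewrite sum_pair exchange_big/=; apply: eq_bigr => b _; apply: eq_bigr => q _.
  by rewrite /ph /M !slice_adj_mulE.
(* Averaged over outcomes, the complement is undisturbed, so its entropy is that of [kgram Phi]. *)
have FS : ksum F = kgram (ktrans Phi).
  have [_ J2] := @isometric_sum_slice d B phi on.
  apply: funext => w; apply: funext => w'; rewrite /ksum /F.
  have -> : kgram (ktrans Phi) w w' = (Phi^a ** Phi) w' w.
    by rewrite /kgram /kmul /kadj /ktrans; apply: eq_bigr => x _; rewrite mulrC.
  rewrite -[Phi^a]kmul1 -J2 kmul_sumr kmul_suml /ksum; apply: eq_bigr => k _.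
  have -> : Phi^a ** (slice phi k ** (slice phi k)^a) ** Phi = (ph k)^a ** ph k.
    by rewrite /ph kadjM kadjK !kmulA.
  by rewrite /kgram /kmul /kadj /ktrans; apply: eq_bigr => x _; rewrite mulrC.
have := @cond_entropy_ptr2 R _ _ _ F (fun k => psd_kgram _).
rewrite ptr2_ksum (eq_ksum FE) ksum_kblock_slice// FS vN_entropy_schmidt.
under eq_bigr do rewrite /F vN_entropy_schmidt -blk.
under [X in _ <= X - _]eq_bigr do rewrite FE.
by rewrite -!vN_entropy_post_meas//; apply: psd_kgram.
Qed.

(** In the bipartite relation, the difference of the post-measurement and original entropies for
    [phi] is replaced by its upper bound, the conditional entropy given [S]. *)
Lemma tripartite_uncertainty d (B S Q : finType) (psi phi : 'I_d -> vec R 'I_d)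
    (Phi : ('I_d * B)%type -> (S * Q)%type -> C) :
  let Phi' (x : 'I_d * S) (z : B * Q) := Phi (x.1, z.1) (x.2, z.2) in
  (0 < d)%N -> orthonormal_basis psi -> orthonormal_basis phi ->
  Re (ktr (kgram Phi)) = 1 ->
  - log2 (cmax psi phi) <=
  (vN_entropy (post_meas psi (kgram Phi)) - vN_entropy (ptr1 (kgram Phi)))
  + (vN_entropy (post_meas phi (kgram Phi')) - vN_entropy (ptr1 (kgram Phi'))).
Proof.
move=> Phi' d0 on1 on2 tr1.
have := bipartite_uncertainty d0 on1 on2 (psd_kgram Phi) tr1.
have := complement_entropy_le Phi on2; rewrite -/Phi'.
move: (vN_entropy _) (vN_entropy _) (vN_entropy _) (vN_entropy _) (vN_entropy _)
  (vN_entropy _) => x1 x2 x3 x4 x5 x6.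
lra.
Qed.

(** The measured reduced state is diagonal in the measured basis, with the outcome probabilities as
    eigenvalues. *)
Lemma vN_entropy_measured d (B : finType) (psi : 'I_d -> vec R 'I_d)
    (f : op R ('I_d * B)%type) : orthonormal_basis psi -> psd_op f ->
  vN_entropy (trace_2 (post_meas psi f)) = shannonH (trace_2 f) psi.
Proof.
move=> on pf; have [_ pA] : psd_op (trace_2 f) := psd_ptr2 pf.
pose e a k := psi k a.
have probE k : \sum_a \sum_a' (psi k a)^* * trace_2 f a a' * psi k a' =
    (prob (trace_2 f) psi k)%:C.
  by rewrite /prob RRe_real// ger0_real// pA.
have prob0 k : 0 <= prob (trace_2 f) psi k by rewrite -ler0c -probE pA.
have sd : spectral_dec (trace_2 (post_meas psi f)) e (prob (trace_2 f) psi).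
  split; [exact: orthonormal_basis_complete|exact: prob0|].
  apply: funext => a; apply: funext => a'; rewrite [RHS]/kmul.
  transitivity (\sum_k psi k a * (psi k a')^* *
     \sum_a1 \sum_a2 (psi k a1)^* * trace_2 f a1 a2 * psi k a2); last first.
    by apply: eq_bigr => k _; rewrite kmul_diagr probE /kadj /e mulrAC.
  rewrite /trace_2 /post_meas exchange_big/=; apply: eq_bigr => k _.
  rewrite exchange_big/= mulr_sumr; apply: eq_bigr => a1 _.
  rewrite exchange_big/= mulr_sumr; apply: eq_bigr => a2 _.
  rewrite mulr_sumr mulr_suml mulr_sumr; apply: eq_bigr => b _.
  by rewrite /ketbra; ring.
apply: (mulIf (lt0r_neq0 (@ln2_gt0 R))); rewrite (vN_entropy_spectral sd).
rewrite /shannonH mulNr mulr_suml; congr (- _); apply: eq_bigr => k _.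
by rewrite xlog2xE divfK// lt0r_neq0// ln2_gt0.
Qed.

End Slices.

(** * Marginals of the multipartite state and their purifications *)

Section Marginals.
Variable R : realType.
Local Notation C := R[i].

Lemma sum_fiber (V : nmodType) (X Y B : finType) (h : X -> B)
    (P : B -> X -> pred Y) (F : X -> Y -> V) :
  \sum_b \sum_x \sum_(y | (h x == b) && P b x y) F x y =
  \sum_x \sum_(y | P (h x) x y) F x y.
Proof.
rewrite exchange_big/=; apply: eq_bigr => x _.
rewrite (bigD1 (h x))//= [X in _ + X]big1 ?addr0 => [|b /negPf hb].
  by apply: eq_bigl => y; rewrite eqxx.
by rewrite big_pred0// => y; rewrite eq_sym hb.
Qed.

(** The coordinates [be] and [ga] that are traced out join the purifying index [E], so a marginal of
    a Gram kernel is again a Gram kernel. *)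
Lemma marginal_kgram (X U V W E : finType) (al : X -> U) (be : X -> V) (ga : X -> W)
    (Psi : X -> E -> C) u u' :
  \sum_x \sum_(y | [&& al x == u, al y == u', be x == be y & ga x == ga y])
     kgram Psi x y =
  kgram (fun u z => \sum_(x | [&& al x == u, be x == z.1 & ga x == z.2.1])
     Psi x z.2.2) u u'.
Proof.
pose D u x (z : V * (W * E)) : C := [&& al x == u, be x == z.1 & ga x == z.2.1]%:R.
transitivity (\sum_z \sum_x \sum_y (D u x z * D u' y z) * (Psi x z.2.2 * (Psi y z.2.2)^*)).
  rewrite [RHS]exchange_big/=; apply: eq_bigr => x _.
  rewrite [RHS]exchange_big/= big_mkcond/=; apply: eq_bigr => y _.
  rewrite sum_pair; under [RHS]eq_bigr do rewrite sum_pair/=.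
  rewrite (bigD1 (be x))//= [X in _ = _ + X]big1 ?addr0 => [|v /negPf vx]; last first.
    rewrite big1// => w _; rewrite big1// => e _.
    by rewrite /D/= [be x == v]eq_sym vx andbF !mul0r.
  rewrite (bigD1 (ga x))//= [X in _ = _ + X]big1 ?addr0 => [|w /negPf vx]; last first.
    by rewrite big1// => e _; rewrite /D/= [ga x == w]eq_sym vx !andbF !mul0r.
  under [RHS]eq_bigr do rewrite /D/= !eqxx !andbT -natrM mulnb.
  rewrite -mulr_sumr [be y == _]eq_sym [ga y == _]eq_sym.
  by case: ifP => _; rewrite ?mul1r ?mul0r.
rewrite [RHS]/kmul; apply: eq_bigr => z _; rewrite /kadj rmorph_sum mulr_suml.
rewrite [RHS]big_mkcond/=; apply: eq_bigr => x _.
under eq_bigr do rewrite -mulrA.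
rewrite /D; case: ifP => _; last by rewrite big1// => y _; rewrite mul0r.
rewrite mulr_sumr [RHS]big_mkcond/=; apply: eq_bigr => y _.
by rewrite mul1r; case: ifP => _; rewrite ?mul1r ?mul0r.
Qed.

Variables (d n : nat) (db : 'I_n -> nat) (rho : op R (TI d db)).

Lemma eq_dffun_split (t : 'I_n) (x y : {dffun forall t : 'I_n, 'I_(db t)}) :
  (x == y) = (x t == y t) && [forall s, (s != t) ==> (x s == y s)].
Proof.
apply/eqP/andP => [->|[/eqP xt /forallP h]].
  by split=> //; apply/forallP => s; rewrite eqxx implybT.
apply/ffunP => s; have [->//|st] := eqVneq s t.
by have /implyP/(_ st)/eqP := h s.
Qed.

Lemma trace_2_rho_ABt t : trace_2 (@rho_ABt R d n db rho t) = rho_A rho.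
Proof.
apply: funext => a; apply: funext => a'; rewrite /trace_2 /rho_ABt /rho_A /=.
transitivity (\sum_b \sum_(x : TI d db) \sum_(y : TI d db | (x.2 t == b) &&
    [&& x.1 == a, y.1 == a', y.2 t == b
      & [forall s, (s != t) ==> (x.2 s == y.2 s)]]) rho x y).
  apply: eq_bigr => b _; apply: eq_bigr => x _; apply: eq_bigl => y.
  by case: (x.1 == a); case: (y.1 == a'); case: (x.2 t == b).
rewrite (sum_fiber (fun x : TI d db => x.2 t) (fun b (x y : TI d db) =>
   [&& x.1 == a, y.1 == a', y.2 t == b & [forall s, (s != t) ==> (x.2 s == y.2 s)]])).
apply: eq_bigr => x _; apply: eq_bigl => y.
by rewrite (eq_dffun_split t) [y.2 t == _]eq_sym.
Qed.

Lemma ptr1_rho_ABt t : ptr1 (@rho_ABt R d n db rho t) = @rho_Bt R d n db rho t.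
Proof.
apply: funext => b; apply: funext => b'; rewrite /ptr1 /rho_ABt /rho_Bt /=.
rewrite (sum_fiber (fun x : TI d db => x.1) (fun a (x y : TI d db) => [&& y.1 == a
   , x.2 t == b, y.2 t == b' & [forall s, (s != t) ==> (x.2 s == y.2 s)]])).
apply: eq_bigr => x _; apply: eq_bigl => y.
by rewrite [y.1 == _]eq_sym; case: (x.1 == y.1); case: (x.2 t == b); case: (y.2 t == b').
Qed.

Lemma ktr_rho_A : ktr (rho_A rho) = ktr rho.
Proof.
rewrite /tr_op /rho_A (sum_fiber (fun x : TI d db => x.1)
  (fun a (x y : TI d db) => (y.1 == a) && (x.2 == y.2))).
apply: eq_bigr => x _; rewrite (big_pred1 x)// => y /=.
by rewrite -pair_eqE/= eq_sym [x.2 == _]eq_sym.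
Qed.

Lemma ktr_rho_ABt t : ktr (@rho_ABt R d n db rho t) = ktr rho.
Proof. by rewrite -ktr_rho_A -(trace_2_rho_ABt t) -(ktr_ptr2 (@rho_ABt R d n db rho t)). Qed.

(** Coordinates of a dependent function cannot be dropped, so the forgotten ones become [None];
    equality then compares only the others. *)
Definition erase (P : pred 'I_n) (y : {dffun forall t : 'I_n, 'I_(db t)}) :
  {dffun forall t : 'I_n, option 'I_(db t)} :=
  [ffun u => if P u then None else Some (y u)].

Lemma eq_erase P x y :
  (erase P x == erase P y) = [forall s, ~~ P s ==> (x s == y s)].
Proof.
apply/eqP/forallP => [/ffunP h s|h].
  by apply/implyP => /negPf Ps; have := h s; rewrite !ffunE Ps => -[->].
apply/ffunP => s; rewrite !ffunE; case: ifPn => // Ps.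
by have /implyP/(_ Ps)/eqP -> := h s.
Qed.

(** The purification [Psi] with the system and memory [t] on one side, and memory [s], the other
    memories and [E] on the other. The conditions fix every coordinate of [x], so the sum has at
    most one term. *)
Definition amplitude (E : finType) (Psi : TI d db -> E -> C) (t s : 'I_n) :
  ('I_d * 'I_(db t))%type -> ('I_(db s) *
     ({dffun forall t : 'I_n, option 'I_(db t)} * E))%type -> C :=
  fun p z => \sum_(x : TI d db | [&& (x.1, x.2 t) == p, x.2 s == z.1
     & erase (pred2 t s) x.2 == z.2.1]) Psi x z.2.2.

Arguments amplitude {E} Psi t s.

Lemma rho_ABt_amplitude (E : finType) (Psi : TI d db -> E -> C) (t s : 'I_n) : t != s ->
  rho = kgram Psi -> @rho_ABt R d n db rho t = kgram (amplitude Psi t s).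
Proof.
move=> ts ->; apply: funext => p; apply: funext => q.
rewrite /amplitude -(marginal_kgram (fun x : TI d db => (x.1, x.2 t))
  (fun x : TI d db => x.2 s) (fun x : TI d db => erase (pred2 t s) x.2)).
rewrite /rho_ABt; apply: eq_bigr => x _; apply: eq_bigl => y.
case: p q => [a b] [a' b']; rewrite !xpair_eqE/= eq_erase.
(* The coordinates other than [t] are [s], which differs from [t], and those kept by [erase]. *)
have -> : [forall s, (s != t) ==> (x.2 s == y.2 s)] =
   (x.2 s == y.2 s) && [forall u, ~~ pred2 t s u ==> (x.2 u == y.2 u)].
  apply/forallP/andP => [h|[xs /forallP h] u].
    split; first by have := h s; rewrite eq_sym ts.
    apply/forallP => u; apply/implyP; rewrite /= negb_or => /andP[ut _].
    by have /implyP := h u; apply.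
  apply/implyP => ut; have [->//|us] := eqVneq u s.
  by have /implyP := h u; apply; rewrite /= negb_or ut.
by case: (x.1 == a); case: (x.2 t == b); case: (y.1 == a'); case: (y.2 t == b').
Qed.

Lemma amplitude_swap (E : finType) (Psi : TI d db -> E -> C) (t s : 'I_n) :
  amplitude Psi s t =
  fun x z => amplitude Psi t s (x.1, z.1) (x.2, z.2).
Proof.
apply: funext => -[a c]; apply: funext => -[b z]; apply: eq_bigl => x /=.
rewrite !xpair_eqE -!andbA; congr (_ && _); rewrite andbCA; do 2 congr (_ && _).
congr (_ == _); apply/ffunP => u; rewrite !ffunE /= orbC.
by [].
Qed.

End Marginals.

(** * Sums over pairs of measurements *)

Section PairSums.
Variable R : realType.

Lemma log2_prod (I : finType) (P : pred I) (F : I -> R) : (forall i, 0 < F i) ->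
  log2 (\prod_(i | P i) F i) = \sum_(i | P i) log2 (F i).
Proof.
move=> F0; rewrite /log2 -mulr_suml; congr (_ / _).
suff [] : 0 < \prod_(i | P i) F i /\ ln (\prod_(i | P i) F i) = \sum_(i | P i) ln (F i).
  by [].
elim/big_rec2: _ => [|i x y _ [y0 <-]]; first by rewrite ltr01 ln1.
by rewrite mulr_gt0// lnM ?posrE.
Qed.

Lemma sum_lt_sym (m : nat) (G : 'I_m -> 'I_m -> R) : (forall i j, G i j = G j i) ->
  2 * \sum_(i < m) \sum_(j < m | (i < j)%N) G i j =
  \sum_(i < m) \sum_(j < m | j != i) G i j.
Proof.
move=> Gsym; have -> : \sum_(i < m) \sum_(j < m | j != i) G i j =
    \sum_(i < m) \sum_(j < m | (i < j)%N) G i j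
    + \sum_(i < m) \sum_(j < m | (j < i)%N) G i j.
  rewrite -big_split/=; apply: eq_bigr => i _.
  rewrite (bigID (fun j : 'I_m => (i < j)%N))/=; congr (_ + _); apply: eq_bigl => j.
    by rewrite -val_eqE/=; case: ltngtP.
  by rewrite -val_eqE/=; case: ltngtP.
rewrite mulrDl !mul1r; congr (_ + _).
rewrite (exchange_big_dep xpredT)//=; apply: eq_bigr => i _.
by apply: eq_bigr => j _; apply: Gsym.
Qed.

(** Each index lies in [m - 1] unordered pairs. *)
Lemma sum_lt_add (m : nat) (a : 'I_m -> R) :
  \sum_(i < m) \sum_(j < m | (i < j)%N) (a i + a j) = m.-1%:R * \sum_i a i.
Proof.
apply: (@mulfI _ 2); first by rewrite pnatr_eq0.
rewrite (sum_lt_sym (G := fun i j => a i + a j)); last by move=> *; rewrite addrC.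
under eq_bigr do rewrite big_split/=; rewrite big_split/=.
have -> : \sum_(i < m) \sum_(j < m | j != i) a j = \sum_(i < m) \sum_(j < m | j != i) a i.
  rewrite (exchange_big_dep xpredT)//=; apply: eq_bigr => i _.
  by apply: eq_bigl => j; rewrite eq_sym.
have -> : \sum_(i < m) \sum_(j < m | j != i) a i = m.-1%:R * \sum_i a i.
  rewrite mulr_sumr; apply: eq_bigr => i _; rewrite sumr_const.
  by rewrite cardC1 card_ord mulr_natl.
ring.
Qed.

(** Only pairs inside one class contribute, and a class of size [r] contains [r (r - 1) / 2] of
    them. *)
Lemma sum_lt_class (m n : nat) (tau : 'I_m -> 'I_n) (S : 'I_n -> {set 'I_m})
    (s : 'I_n -> R) : (forall i t, (i \in S t) = (tau i == t)) ->
  \sum_(i < m) \sum_(j < m | (i < j)%N) (tau i == tau j)%:R * s (tau i) =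
  \sum_(t < n) ((#|S t| * (#|S t|).-1)%:R / 2) * s t.
Proof.
move=> St; apply: (@mulfI _ 2); first by rewrite pnatr_eq0.
rewrite (sum_lt_sym (G := fun i j => (tau i == tau j)%:R * s (tau i))); last first.
  by move=> i j; rewrite eq_sym; case: eqP => [->|]; rewrite ?mul0r.
rewrite mulr_sumr (partition_big tau xpredT)//=; apply: eq_bigr => t _.
transitivity (\sum_(i in S t) (#|S t|.-1)%:R * s t); last first.
  by rewrite sumr_const natrM -mulr_natl; field.
rewrite [RHS](eq_bigl (fun i => tau i == t)) => [|i]; last by rewrite St.
apply: eq_bigr => i /eqP it; rewrite it -mulr_suml; congr (_ * _).
have iS : i \in S t by rewrite St it.
rewrite -natr_sum; congr (_%:R); rewrite (cardsD1 i) iS add1n /= -sum1_card.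
rewrite [RHS]big_mkcond/= big_mkcond/=; apply: eq_bigr => j _.
by rewrite !inE St [t == _]eq_sym; case: (j != i); case: (tau j == t).
Qed.

End PairSums.

(** * Bounds for pairs of measurements on the given state *)

Section State.
Variable R : realType.
Variables (d n : nat) (db : 'I_n -> nat) (rho : op R (TI d db)).
Hypothesis rhoD : density_op rho.

Lemma density_op_dim_gt0 : (0 < d)%N.
Proof.
have [_] := rhoD; rewrite lt0n; case: eqP => // d0; rewrite /tr_op big1.
  by move=> /esym/eqP; rewrite oner_eq0.
by case=> -[i lt_id] y _; exfalso; move: lt_id; rewrite d0.
Qed.

Lemma psd_rho_ABt t : psd_op (@rho_ABt R d n db rho t).
Proof.
have [/psd_op_kgram[Psi rhoE] _] := rhoD.
(* The coordinate [tt] is a dummy: no second memory is singled out here. *)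
have -> : @rho_ABt R d n db rho t = kgram (fun p z =>
    \sum_(x : TI d db | [&& (x.1, x.2 t) == p, tt == z.1
      & erase (pred1 t) x.2 == z.2.1]) Psi x z.2.2).
  apply: funext => p; apply: funext => q.
  rewrite -(marginal_kgram (fun x : TI d db => (x.1, x.2 t))
    (fun=> tt) (fun x : TI d db => erase (pred1 t) x.2)) -rhoE.
  rewrite /rho_ABt; apply: eq_bigr => x _; apply: eq_bigl => y.
  case: p q => [a b] [a' b']; rewrite !xpair_eqE/= eq_erase.
  by case: (x.1 == a); case: (x.2 t == b); case: (y.1 == a'); case: (y.2 t == b').
exact: psd_kgram.
Qed.

Lemma ktr_rho_ABt1 t : Re (tr_op (@rho_ABt R d n db rho t)) = 1.
Proof. by have [_ tr1] := rhoD; rewrite ktr_rho_ABt tr1. Qed.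

Lemma condS_same (psi phi : 'I_d -> vec R 'I_d) t :
  orthonormal_basis psi -> orthonormal_basis phi ->
  - log2 (cmax psi phi) + condS_ABt rho t <=
  condS_MBt rho psi t + condS_MBt rho phi t.
Proof.
move=> on1 on2.
have := bipartite_uncertainty density_op_dim_gt0 on1 on2 (psd_rho_ABt t) (ktr_rho_ABt1 t).
rewrite ptr1_rho_ABt /condS_ABt /condS_MBt.
move: (vN_entropy _) (vN_entropy _) (vN_entropy _) (vN_entropy _) => x1 x2 x3 x4.
lra.
Qed.

(** In a purification of [rho], memory [s] belongs to the complement of the system and memory [t];
    exchanging the two memories in the amplitude gives the state on the system and memory [s]. *)
Lemma condS_distinct (psi phi : 'I_d -> vec R 'I_d) (t s : 'I_n) : t != s ->
  orthonormal_basis psi -> orthonormal_basis phi ->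
  - log2 (cmax psi phi) <= condS_MBt rho psi t + condS_MBt rho phi s.
Proof.
move=> ts on1 on2; have [/psd_op_kgram[Psi rhoE] _] := rhoD.
have rt := rho_ABt_amplitude ts rhoE.
have st : s != t by rewrite eq_sym.
have := rho_ABt_amplitude st rhoE; rewrite amplitude_swap => rs.
have tr1 := ktr_rho_ABt1 t; rewrite rt in tr1.
have := tripartite_uncertainty density_op_dim_gt0 on1 on2 tr1.
by rewrite -rs -rt !ptr1_rho_ABt.
Qed.

(** The joint and memory entropies cancel, leaving the entropy of the measured system. *)
Lemma condS_mutinf (psi : 'I_d -> vec R 'I_d) t : orthonormal_basis psi ->
  condS_MBt rho psi t + mutinf_MBt rho psi t = shannonH (rho_A rho) psi.
Proof.
move=> on; rewrite /condS_MBt /mutinf_MBt.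
rewrite (vN_entropy_measured on (psd_rho_ABt t)) trace_2_rho_ABt.
by move: (vN_entropy _) (vN_entropy _) => x y; ring.
Qed.

End State.

(** * Summation of the pair bounds over all measurements *)

Theorem theorem3 (R : realType) (m n d : nat) (db : 'I_n -> nat)
  (rho : op R (TI d db))
  (M : 'I_m -> op R 'I_d) (psi : 'I_m -> 'I_d -> vec R 'I_d)
  (S : 'I_n -> {set 'I_m}) (U : R) :
  (2 <= m)%N -> (1 <= n <= m)%N ->
  density_op rho ->
  (forall i, herm_op (M i)) ->
  (forall i, orthonormal_basis (psi i)) ->
  (forall i k, is_eigvec (M i) (psi i k)) ->
  (forall t, S t != set0) ->
  (forall t s, t != s -> [disjoint S t & S s]) ->
  \bigcup_(t < n) S t = [set: 'I_m] ->
  \sum_(i < m) shannonH (rho_A rho) (psi i) >= U ->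
  \sum_(t < n) \sum_(i in S t) condS_MBt rho (psi i) t >=
    U_SCB rho psi S
    + Num.max 0 (U - U_SCB rho psi S
                 - \sum_(t < n) \sum_(i in S t) mutinf_MBt rho (psi i) t).
Proof.
move=> m2 _ rhoD _ on _ _ disj cover HU.
(* The partition is read as a map from each measurement to its memory. *)
have [tau tauP] : exists tau : 'I_m -> 'I_n, forall i, i \in S (tau i).
  suff /boolp.choice[tau h] : forall i, exists t, i \in S t by exists tau.
  move=> i; have : i \in \bigcup_(t < n) S t by rewrite cover inE.
  by case/bigcupP => t _ it; exists t.
have St i t : (i \in S t) = (tau i == t).
  apply/idP/eqP => [it|<-//]; apply/eqP; apply: contraT => /disj.
  by move=> /disjoint_setI0/setP/(_ i); rewrite !inE tauP it.
have sumS (F : 'I_m -> 'I_n -> R) :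
    \sum_(t < n) \sum_(i in S t) F i t = \sum_i F i (tau i).
  rewrite [RHS](partition_big tau xpredT)//=; apply: eq_bigr => t _.
  by apply: eq_big => [i|i]; rewrite St// => /eqP ->.
rewrite !sumS; set A := \sum_i condS_MBt _ _ _; set I := \sum_i mutinf_MBt _ _ _.
have AI : U <= A + I.
  rewrite -big_split/=; apply: le_trans HU _; apply: ler_sum => i _.
  by rewrite condS_mutinf.
have UA : U_SCB rho psi S <= A.
  have m1 : 0 < m.-1%:R :> R by rewrite ltr0n; case: (m) m2 => [|[]].
  have c0 i j := cmax_gt0 (density_op_dim_gt0 rhoD) (on i) (on j).
  (* Multiplied by [m - 1], the left side becomes a sum over pairs, and so does [U_SCB]; it remains
     to compare pair by pair. *)
  rewrite /U_SCB mulNr -mulrN -mulrDr mulrC ler_pdivrMr// [A * _]mulrC -sum_lt_add.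
  rewrite -(sum_lt_class _ St) log2_prod; last first.
    by move=> i; apply: prodr_gt0 => j _; apply: c0.
  under eq_bigr => i _ do rewrite log2_prod//.
  rewrite -sumrN -big_split/=; apply: ler_sum => i _.
  rewrite -sumrN -big_split/=; apply: ler_sum => j _.
  have [ij|ij] := eqVneq (tau i) (tau j).
    by rewrite mul1r -ij; apply: condS_same.
  by rewrite mul0r addr0; apply: condS_distinct.
(* If the second term of the maximum is nonnegative the claim is [U - I <= A]; otherwise it is
   [U_SCB <= A]. *)
by case: (leP 0 (U - U_SCB rho psi S - I)) => h; lra.
Qed.
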